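(* Let each $X_j$ ($j=1,\dots,n$) be an $\mathcal{L}_\infty$ space and let $F$ be a Banach space with $\cot F=q$. Then every continuous $n$-linear mapping from $X_1\times\dots\times X_n$ into $F$ is $(q;2,\dots,2)$-summing on $X_1\times\dots\times X_n$ (that is, at every point).
   Context: All spaces are Banach spaces over $\mathbb{K}=\mathbb{R}$ or $\mathbb{C}$. $X$ is an $\mathcal{L}_\infty$ space if there is $\lambda>1$ such that every finite dimensional subspace $G$ of $X$ is contained in a finite dimensional subspace $H$ of $X$ for which there is an isomorphism $v:H\to l_\infty^{\dim H}$ with $\|v\|\|v^{-1}\|<\lambda$. For $2\le q\le\infty$, $F$ has cotype $q$ if there is a constant $C_q(F)\ge0$ such that $(\sum_{j=1}^k\|x_j\|^q)^{1/q}\le C_q(F)\big(\int_0^1\|\sum_{j=1}^k r_j(t)x_j\|^2dt\big)^{1/2}$ for all $k$ and $x_1,\dots,x_k\in F$ ($r_j$ the Rademacher functions; the left side is $\max_j\|x_j\|$ if $q=\infty$). $\cot F=\inf\{2\le q\le\infty: F\text{ has cotype }q\}$. For $0<p<\infty$, $l_p^w(E)$ is the space of sequences $(x_j)$ in $E$ with $\sum_j|\varphi(x_j)|^p<\infty$ for every $\varphi$ in the topological dual $E'$; $l_p(E)$ is the space of sequences with $\sum_j\|x_j\|^p<\infty$; $l_\infty(E)$ is the space of bounded sequences. A continuous $n$-linear $T:E_1\times\dots\times E_n\to F$ is $(p;q_1,\dots,q_n)$-summing at $(a_1,\dots,a_n)$ if $(T(a_1+x_j^{(1)},\dots,a_n+x_j^{(n)})-T(a_1,\dots,a_n))_j\in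 l_p(F)$ whenever $(x_j^{(s)})_j\in l_{q_s}^w(E_s)$, $s=1,\dots,n$.
   Formalization: It is additionally assumed that F has cotype q = cot F, i.e. the infimum defining cot F is attained; otherwise the claim fails, e.g. for a diagonal operator from c_0 into an l_q-sum of spaces l_{p_k}^{m_k} with p_k decreasing to q and m_k growing fast. *)

(* Defs.v *)
(* Stated in MathComp-Analysis; the field of complex numbers is that of
   mathcomp-real-closed. *)
From HB Require Import structures.
From mathcomp Require Import all_boot all_order all_algebra.
From mathcomp Require Import complex.
From mathcomp Require Import all_classical all_reals all_analysis.

Set Implicit Arguments.
Unset Strict Implicit.
Unset Printing Implicit Defensive.
Import Order.TTheory GRing.Theory Num.Theory.
Import numFieldTopology.Exports numFieldNormedType.Exports.
Local Open Scope classical_set_scope.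
Local Open Scope ring_scope.

Variant scalars := RealScalars | ComplexScalars.

Definition scalar_field (R : realType) (k : scalars) : numFieldType :=
  match k with
  | RealScalars => R
  | ComplexScalars => complex R
  end.

(* In a normed module over K the norm is K-valued; when K is the complex field
   its values are nonnegative reals seen in K, and [scalar_re] reads them back
   in R. *)
Definition scalar_re (R : realType) (k : scalars) : scalar_field R k -> R :=
  match k return scalar_field R k -> R with
  | RealScalars => fun x => x
  | ComplexScalars => fun x => complex.Re x
  end.

Definition rnorm (R : realType) (k : scalars)
    (V : normedZmodType (scalar_field R k)) (x : V) : R :=
  scalar_re `|x|.

Section Linfty.
Context (R : realType) (k : scalars).
Local Notation K := (scalar_field R k).

(* Norm of the restriction of f to D; intended for D a linear subspace on
   which f is linear. *)
Definition opnorm_on (V W : normedModType K) (D : set V) (f : V -> W) : \bar R :=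
  ereal_sup [set (rnorm (f x))%:E | x in [set x | D x /\ rnorm x <= 1]].

Definition subspace_of_dim (X : normedModType K) (m : nat) (G : set X) :=
  exists b : 'I_m -> X,
    (forall c : 'I_m -> K, \sum_i c i *: b i = 0 -> forall i, c i = 0) /\
    G = [set x | exists c : 'I_m -> K, x = \sum_i c i *: b i].

(* [v] restricts to a linear bijection from H onto W with inverse [w]; the
   values of [v] outside H are irrelevant. *)
Definition linear_iso_on (X W : normedModType K) (H : set X)
    (v : X -> W) (w : W -> X) :=
  [/\ forall (a : K) x y, H x -> H y -> v (a *: x + y) = a *: v x + v y,
      forall y, H (w y),
      forall x, H x -> w (v x) = x &
      forall y, v (w y) = y].

(* The norm of ['rV[K]_m] is the maximum of the moduli of the coordinates, so
   this normed space is l_oo^m. *)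
Definition Linfty_space (X : normedModType K) :=
  exists2 lambda : R, 1 < lambda &
    forall (G : set X) (d : nat), subspace_of_dim d G ->
    exists (H : set X) (m : nat), [/\ subspace_of_dim m H, G `<=` H &
      exists (v : X -> 'rV[K]_m) (w : 'rV[K]_m -> X),
        linear_iso_on H v w /\
        (opnorm_on H v * opnorm_on setT w < lambda%:E)%E].

End Linfty.

(* Rademacher functions r_j(t) = sign (sin (2^j pi t)), j >= 1, with values
   in {-1, 0, 1}. *)
Definition rademacher (R : realType) (j : nat) (t : R) : int :=
  sgz (sin (2 ^+ j * pi * t)).

Section Cotype.
Context (R : realType) (k : scalars).
Local Notation K := (scalar_field R k).

(* The value at -oo is a dummy. *)
Definition lq_norm (F : normedModType K) (q : \bar R) (m : nat)
    (x : 'I_m -> F) : R :=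
  match q with
  | r%:E => (\sum_j rnorm (x j) `^ r) `^ r^-1
  | +oo%E => \big[Num.max/0]_j rnorm (x j)
  | -oo%E => 0
  end.

Definition rademacher_average (F : normedModType K) (m : nat)
    (x : 'I_m -> F) : R :=
  Num.sqrt (\int[lebesgue_measure]_(t in `[0, 1])
              (rnorm (\sum_(j < m) x j *~ rademacher j.+1 t) ^+ 2)).

(* Meant for 2 <= q <= +oo. *)
Definition has_cotype (F : normedModType K) (q : \bar R) :=
  exists2 C : R, 0 <= C &
    forall (m : nat) (x : 'I_m -> F), lq_norm q x <= C * rademacher_average x.

(* The infimum need not be attained: F may fail to have cotype [cot F]. *)
Definition cot (F : normedModType K) : \bar R :=
  ereal_inf [set q : \bar R | (2%:E <= q)%E /\ has_cotype F q].

End Cotype.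

Section Summing.
Context (R : realType) (k : scalars).
Local Notation K := (scalar_field R k).

(* Membership in l_p(E), 0 < p <= +oo. *)
Definition strongly_summable (E : normedModType K) (p : \bar R)
    (x : nat -> E) : Prop :=
  match p with
  | r%:E => (\sum_(0 <= j <oo) (rnorm (x j) `^ r)%:E < +oo)%E
  | +oo%E => exists M : R, forall j, rnorm (x j) <= M
  | -oo%E => False
  end.

(* Membership in l_p^w(E), 0 < p < +oo. *)
Definition weakly_summable (E : normedModType K) (p : R)
    (x : nat -> E) : Prop :=
  forall phi : {linear E -> K^o}, continuous phi ->
    (\sum_(0 <= j <oo) (rnorm (phi (x j)) `^ p)%:E < +oo)%E.

Definition multilinear (n : nat) (E : 'I_n -> normedModType K)
    (F : normedModType K) (T : (forall s, E s) -> F) :=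
  forall (s : 'I_n) (x : forall s, E s),
    linear (fun y : E s => T (dfwith x s y)).

Definition summing_at (n : nat) (E : 'I_n -> normedModType K)
    (F : normedModType K) (p : \bar R) (q : 'I_n -> R)
    (T : (forall s, E s) -> F) (a : forall s, E s) :=
  forall x : (forall s, nat -> E s),
    (forall s, weakly_summable (q s) (x s)) ->
    strongly_summable p (fun j => T (fun s => a s + x s j) - T a).

End Summing.

(* Main.v *)
Require Import Defs.
From HB Require Import structures.
From mathcomp Require Import all_boot all_order all_algebra.
From mathcomp Require Import complex ring lra.
From mathcomp Require Import all_classical all_reals all_analysis.
From mathcomp Require Import measurable_realfun.
Set Implicit Arguments.
Unset Strict Implicit.
Unset Printing Implicit Defensive.
Import Order.TTheory GRing.Theory Num.Theory.
Import numFieldTopology.Exports numFieldNormedType.Exports.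
Local Open Scope classical_set_scope.
Local Open Scope ring_scope.

(** Switching the variables from [a s] to [a s + x s j] one at a time writes
    [T (a + x j) - T a] as a sum of [n] terms. In each of them one variable is
    [x s0 j], some are [a s + x s j] and the others are [a s]. It is enough to
    bound, for each term, the sums over [j < m] independently of [m]
    ([mixed_args_summing], [multilinear_summing]).

    Reduction to sup-norms. Let [x] be weakly square-summable in an [L_oo] space.
    The vectors [\sum_j a j *: x j] with [\sum_j a j ^ 2 <= 1] are weakly bounded,
    hence bounded in norm ([weakly_bounded_norm_bounded], a gliding hump argument
    on top of the Hahn-Banach theorem [norming_functional]). So the coordinates of
    the isomorphisms onto [l_oo^N] send [x] to families with bounded square sums,
    and any finite part of [x] is the image, under an operator of bounded norm, of
    a family in some [l_oo^N] whose coordinates have square sums at most 1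
    ([Linfty_factorization]). Functionals are treated as real-linear ones, which
    covers both scalar fields.

    One variable. An operator [S] from [l_oo^N] to a space of cotype [q] is
    (q; 2)-summing with a constant that does not depend on [N]. In finite
    dimension the best constant is finite, and it suffices to bound it by a
    universal constant plus a small multiple of itself
    ([self_improving_bound]).
    - For [q = 2], cotype bounds [\sum_j |S x_j| ^ 2] by the mean of [|S G| ^ 2],
      with [G = \sum_j +- x_j]. Truncating [G] at a fixed level leaves a bounded
      function, controlled by the norm of [S], and a remainder of small mean
      square by the fourth moment of [G], controlled by the best constant
      ([cotype2_sup_contraction_summing]).
    - For [q > 2], the best constant is taken over weighted families. Entries of
      modulus at most [eta] gain a factor [eta ^ (q - 2)]. The large entries are
      selected at random with probabilities equal to their weights: where few of
      them overlap, cotype applies to all choices of signs, and elsewhere little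
      mass is left by Chebyshev's inequality ([weighted_sum_large],
      [cotype_gt2_sup_contraction_summing]).

    The other variables. A family [x] in [l_oo^N] with square sums at most 1 can
    be written [x_j = E (r_j W)], with [W] a bounded function of the signs [r]: the
    imaginary part of the Riesz product [\prod_j (1 + i r_j x_j)] has this property
    for real scalars ([bounded_walsh_lift]). Thus a variable [x s j] is a mean of
    bounded vectors [+- W r] which, up to the sign, do not depend on [j]; by
    convexity of the power [q] it may be frozen at such a vector, and an induction
    on the number of non-frozen variables leads back to one variable.

    Cotype is given through the integral of the Rademacher functions over [0, 1],
    which is a mean over the finite cube of signs ([sqr_rademacher_average]). For
    infinite [q] it suffices that [T] is bounded on bounded sets and that the
    sequences [x s] are bounded. *)

(** * Real-valued norms over the two scalar fields *)

Section Scalars.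
Context (R : realType) (k : scalars).
Local Notation K := (scalar_field R k).

Definition kemb : R -> K :=
  match k return R -> scalar_field R k with
  | RealScalars => fun x => x
  | ComplexScalars => fun x => x%:C%C
  end.

Definition kim : K -> R :=
  match k return scalar_field R k -> R with
  | RealScalars => fun=> 0
  | ComplexScalars => fun x => complex.Im x
  end.

Local Notation kre := (@scalar_re R k).

Lemma kemb_is_zmod_morphism : zmod_morphism kemb.
Proof. by rewrite /kemb; case: k => //= x y; rewrite rmorphB. Qed.
Lemma kemb_is_monoid_morphism : monoid_morphism kemb.
Proof. by rewrite /kemb; case: k => //=; split=> // x y; rewrite rmorphM. Qed.
HB.instance Definition _ := GRing.isZmodMorphism.Build R K kemb kemb_is_zmod_morphism.
HB.instance Definition _ := GRing.isMonoidMorphism.Build R K kemb kemb_is_monoid_morphism.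

Lemma ler_kemb (a b : R) : (kemb a <= kemb b) = (a <= b).
Proof. by rewrite /kemb; case: k => //=; rewrite lecR. Qed.

Lemma ltr_kemb (a b : R) : (kemb a < kemb b) = (a < b).
Proof. by rewrite /kemb; case: k => //=; rewrite ltcR. Qed.

Lemma kreK : cancel kemb kre.
Proof. by rewrite /kemb /scalar_re; case: k. Qed.

Lemma kimK a : kim (kemb a) = 0.
Proof. by rewrite /kemb /kim; case: k. Qed.

Lemma kre_is_zmod_morphism : zmod_morphism kre.
Proof. by rewrite /scalar_re; case: k => //= x y; rewrite raddfB. Qed.
HB.instance Definition _ := GRing.isZmodMorphism.Build K R kre kre_is_zmod_morphism.
Lemma kim_is_zmod_morphism : zmod_morphism kim.
Proof. by rewrite /kim; case: k => //= x y; rewrite ?subr0 ?raddfB. Qed.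
HB.instance Definition _ := GRing.isZmodMorphism.Build K R kim kim_is_zmod_morphism.

Lemma kreM a (x : K) : kre (kemb a * x) = a * kre x.
Proof. by move: x; rewrite /kemb /scalar_re; case: k => //= -[x y] /=; rewrite mul0r subr0. Qed.
Lemma kimM a (x : K) : kim (kemb a * x) = a * kim x.
Proof. by move: x; rewrite /kemb /kim; case: k => //=[|[x y] /=]; rewrite ?mulr0 ?mul0r ?addr0. Qed.

Section Norm.
Context (V : normedZmodType K).
Implicit Types x y : V.

Lemma rnormE x : `|x| = kemb (rnorm x).
Proof.
rewrite /rnorm; have := normr_ge0 x; move: `|x|.
rewrite /kemb /scalar_re; case: k => // -[a b] /=.
by rewrite lecE /= => /andP[/eqP -> _].
Qed.

Lemma rnorm_ge0 x : 0 <= rnorm x.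
Proof. by rewrite -ler_kemb -rnormE rmorph0 normr_ge0. Qed.
Lemma ler_rnormD x y : rnorm (x + y) <= rnorm x + rnorm y.
Proof. by rewrite -ler_kemb rmorphD /= -!rnormE ler_normD. Qed.
Lemma rnormN x : rnorm (- x) = rnorm x.
Proof. by rewrite /rnorm normrN. Qed.
Lemma rnorm0 : rnorm (0 : V) = 0.
Proof. by rewrite /rnorm normr0 raddf0. Qed.
Lemma rnorm_eq0 x : rnorm x = 0 -> x = 0.
Proof. by move=> h; apply/eqP; rewrite -normr_eq0 rnormE h rmorph0. Qed.
Lemma ler_dist_rnormDB x y : `|rnorm (x + y) - rnorm (x - y)| <= 2 * rnorm y.
Proof.
have h1 := ler_rnormD (x - y) (y + y); rewrite addrA subrK in h1.
have h2 := ler_rnormD (x + y) (- (y + y)); rewrite rnormN opprD addrA addrK in h2.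
by have h3 := ler_rnormD y y; rewrite ler_norml; apply/andP; split; lra.
Qed.
Lemma ler_rnorm_sum (I : finType) (P : pred I) (f : I -> V) :
  rnorm (\sum_(i | P i) f i) <= \sum_(i | P i) rnorm (f i).
Proof.
elim/big_rec2: _ => [|i y x _ h]; first by rewrite rnorm0.
by rewrite (le_trans (ler_rnormD _ _))// lerD2l.
Qed.
End Norm.

Lemma rnormK (x : K) : rnorm x ^+ 2 = kre x ^+ 2 + kim x ^+ 2.
Proof.
rewrite /rnorm /scalar_re /kim; case: k x => x.
  by rewrite expr0n addr0 real_normK// num_real.
case: x => a b.
have h : complex.Re `|(a +i* b)%C : complex R| ^+ 2 = a ^+ 2 + b ^+ 2.
  by rewrite normc_def /= sqr_sqrtr// addr_ge0 ?sqr_ge0.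
exact: h.
Qed.

Lemma rnorm_kemb a : rnorm (kemb a) = `|a|.
Proof.
apply/eqP; rewrite -(@eqrXn2 _ 2%N) ?rnorm_ge0//.
by rewrite rnormK kreK kimK expr0n addr0 real_normK ?num_real.
Qed.

Lemma rnormZ (V : normedModType K) (a : K) (x : V) :
  rnorm (a *: x) = rnorm a * rnorm x.
Proof.
by apply: (can_inj kreK); rewrite -rnormE normrZ !rnormE -rmorphM.
Qed.
Lemma rnormM (a b : K) : rnorm (a * b) = rnorm a * rnorm b.
Proof. exact: (@rnormZ K^o). Qed.

Lemma rnorm_sign (b : bool) : rnorm ((-1) ^+ b : K) = 1.
Proof. by rewrite -(rmorph_sign kemb) rnorm_kemb normr_sign. Qed.
Lemma rnorm_nat n : rnorm (n%:R : K) = n%:R.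
Proof. by rewrite -(rmorph_nat kemb) rnorm_kemb normr_nat. Qed.

Lemma rnorm_parallelogram (a b : K) :
  rnorm (a + b) ^+ 2 + rnorm (a - b) ^+ 2 = 2 * (rnorm a ^+ 2 + rnorm b ^+ 2).
Proof. by rewrite !rnormK !raddfD !raddfN/=; ring. Qed.

(** Taken to be 0 over the reals, so that [x = re x + kI * im x] in both cases. *)
Definition kI : K :=
  match k return scalar_field R k with
  | RealScalars => 0
  | ComplexScalars => 'i%C
  end.

Lemma kreimE (x : K) : x = kemb (kre x) + kI * kemb (kim x).
Proof.
move: x; rewrite /kemb /kI /scalar_re /kim; case: k => [x|x].
  by rewrite mul0r addr0.
exact: complexE.
Qed.

Lemma kI_cases : kI = 0 \/ kI * kI = -1.
Proof.
rewrite /kI; case: k; first by left.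
by right; apply/eqP; rewrite eq_complex /= !mulr0 !mul0r mulr1 sub0r add0r oppr0 !eqxx.
Qed.

Lemma kre_kI (b : R) : kre (kI * kemb b) = 0.
Proof.
rewrite /kemb /kI /scalar_re; case: k; first by rewrite mul0r.
by rewrite /= mul0r mulr0 subr0.
Qed.

Lemma sqr_rnorm_kreim_le (a b : R) :
  rnorm (kemb a + kI * kemb b) ^+ 2 <= a ^+ 2 + b ^+ 2.
Proof.
have h : (a%:C + 'i * b%:C = a +i* b :> complex R)%C.
  by rewrite [RHS]complexE.
rewrite rnormK /kemb /kI /scalar_re /kim; case: k.
  by rewrite mul0r addr0 expr0n/= lerD2l sqr_ge0.
rewrite [X in complex.Re X](h : (_ : scalar_field R ComplexScalars) = _).
by rewrite [X in complex.Im X](h : (_ : scalar_field R ComplexScalars) = _).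
Qed.

Lemma rnorm_kI_le1 : rnorm kI <= 1.
Proof.
have := sqr_rnorm_kreim_le 0 1; rewrite rmorph0 rmorph1 add0r mulr1.
by rewrite expr0n expr1n add0r expr_le1 ?rnorm_ge0.
Qed.

Lemma ler_kim (x : K) : `|kim x| <= rnorm x.
Proof.
rewrite -(@ler_pXn2r _ 2) ?nnegrE ?rnorm_ge0// rnormK real_normK ?num_real//.
by rewrite lerDr sqr_ge0.
Qed.

Lemma ler_kre (x : K) : `|kre x| <= rnorm x.
Proof.
rewrite -(@ler_pXn2r _ 2) ?nnegrE ?rnorm_ge0// rnormK real_normK ?num_real//.
by rewrite lerDl sqr_ge0.
Qed.

End Scalars.

(** * Elementary inequalities *)

Section Elementary.
Context {R : realType}.
Implicit Types (q a b c : R).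

(** A quasi-triangle inequality is all that the bootstrap arguments need, so
    the constant is not optimized. *)
Lemma powRD_le q a b : 0 <= q -> 0 <= a -> 0 <= b ->
  (a + b) `^ q <= 2 `^ q * (a `^ q + b `^ q).
Proof.
move=> q0 a0 b0; wlog ab : a b a0 b0 / a <= b => [h|].
  by have [/h->//|/ltW ba] := leP a b; rewrite addrC [X in _ * X]addrC h.
apply: (@le_trans _ _ ((2 * b) `^ q)).
  by rewrite ge0_ler_powR// ?nnegrE; lra.
by rewrite powRM// ler_wpM2l ?powR_ge0// lerDr powR_ge0.
Qed.

(** Jensen's inequality for the uniform average, read off from Young's
    inequality with second factor a power of the average itself. *)
Lemma powR_mean_le q (I : finType) (a : I -> R) : 1 <= q ->
  (forall i, 0 <= a i) ->
  (#|I|%:R^-1 * \sum_i a i) `^ q <= #|I|%:R^-1 * \sum_i a i `^ q.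
Proof.
move=> q1 a0; set c := #|I|%:R^-1; set s := \sum_i a i.
have c0 : 0 <= c by rewrite invr_ge0.
have [->|qn1] := eqVneq q 1.
  rewrite powRr1 ?mulr_ge0 ?sumr_ge0//.
  by rewrite ler_wpM2l// ler_sum// => i _; rewrite powRr1.
have {qn1}q1 : 1 < q by rewrite lt_neqAle eq_sym qn1.
have q0 : 0 < q by lra.
have s0 : 0 <= s by rewrite sumr_ge0.
set t := c * s; have t0 : 0 <= t by rewrite mulr_ge0.
pose p := q / (q - 1).
have p0 : 0 < p by rewrite divr_gt0; lra.
have pq : q^-1 + p^-1 = 1 by rewrite /p; field; lra.
have young i : a i * t `^ (q - 1) <= a i `^ q / q + t `^ q / p.
  have := @conjugate_powR R (a i) (t `^ (q - 1)) q p (a0 i) (powR_ge0 _ _) q0 p0 pq.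
  by rewrite -powRrM /p mulrCA mulfV ?mulr1//; lra.
have [c00|cn0] := eqVneq c 0.
  by rewrite /t c00 !mul0r powR0 ?gt_eqF.
have cI : c * #|I|%:R = 1 by rewrite mulVf// -invr_eq0.
have : c * \sum_i (a i * t `^ (q - 1)) <= c * \sum_i (a i `^ q / q + t `^ q / p).
  by rewrite ler_wpM2l// ler_sum.
have -> : c * \sum_i (a i * t `^ (q - 1)) = t * t `^ (q - 1).
  by rewrite -mulr_suml mulrA.
have -> : c * \sum_i (a i `^ q / q + t `^ q / p) =
    (c * \sum_i a i `^ q) / q + t `^ q / p.
  rewrite big_split/= -mulr_suml mulrDr; congr (_ + _); first by rewrite mulrA.
  rewrite (_ : \sum_(i : I) _ = #|I|%:R * (t `^ q / p)); last first.
    by rewrite sumr_const mulr_natl.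
  by rewrite (mulrA c) cI mul1r.
have [->|tn0] := eqVneq t 0.
  by rewrite (powR0 (x := q)) ?gt_eqF// => _; rewrite mulr_ge0 ?sumr_ge0// => i _; exact: powR_ge0.
have -> : t * t `^ (q - 1) = t `^ q.
  by rewrite -{1}(powRr1 t0) -powRD ?tn0 ?implybT//; congr (_ `^ _); ring.
move=> h.
have {h} : t `^ q * (1 - p^-1) <= (c * \sum_i a i `^ q) / q by lra.
by rewrite -pq addrK ler_pM2r ?invr_gt0.
Qed.

Lemma powR_sum_le q n (a : 'I_n -> R) : 1 <= q -> (forall i, 0 <= a i) ->
  (\sum_i a i) `^ q <= n%:R `^ q * \sum_i a i `^ q.
Proof.
move=> q1 a0; case: n a a0 => [|n] a a0.
  by rewrite !big_ord0 mulr0 powR0// gt_eqF//; lra.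
have := powR_mean_le q1 a0; rewrite card_ord => h.
have n0 : 0 < n.+1%:R :> R by rewrite ltr0n.
rewrite -[X in X `^ q](mulVKf (lt0r_neq0 n0)) [leLHS]powRM ?(ltW n0)//; last first.
  by rewrite mulr_ge0 ?invr_ge0 ?(ltW n0)// sumr_ge0.
rewrite ler_wpM2l ?powR_ge0// (le_trans h)// ler_piMl ?sumr_ge0//.
  by move=> i _; rewrite powR_ge0.
by rewrite invf_le1// ler1n.
Qed.

(** [P] consists of the values whose supremum is a best constant. That supremum
    is finite by the crude bound [N], and so it satisfies the same inequality
    [A <= c + A / 2] as the upper bounds. *)
Lemma self_improving_bound (P : set R) (N c : R) :
  (forall v, P v -> v <= N) ->
  (forall A, (forall v, P v -> v <= A) -> forall v, P v -> v <= c + A / 2) ->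
  forall v, P v -> v <= 2 * c.
Proof.
move=> PN step v Pv.
have ub : has_ubound P by exists N.
have supP w : P w -> w <= sup P by move=> Pw; apply: ub_le_sup.
have : sup P <= c + sup P / 2.
  by apply: ge_sup; [exists v|exact: step supP].
by have := supP v Pv; lra.
Qed.

End Elementary.

(** * Independent signs *)

Section Signs.
Context {R : realType} {k : scalars}.
Local Notation K := (scalar_field R k).
Context {m : nat}.
Implicit Types (e : {ffun 'I_m -> bool}) (j : 'I_m).

Local Notation sg e j := ((-1) ^+ (e j : bool)).

Definition flip j e : {ffun 'I_m -> bool} := [ffun i => e i (+) (i == j)].

Lemma flipK j : involutive (flip j).
Proof. by move=> e; apply/ffunP => i; rewrite !ffunE addbK. Qed.

Lemma sum_flip j (f : {ffun 'I_m -> bool} -> R) :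
  2 * \sum_e f e = \sum_e (f e + f (flip j e)).
Proof.
rewrite big_split/= [X in _ = _ + X](_ : _ = \sum_e f e); first by ring.
by rewrite [RHS](reindex_inj (inv_inj (flipK j))).
Qed.

Lemma card_signs : #|{ffun 'I_m -> bool}| = (2 ^ m)%N.
Proof. by rewrite card_ffun card_bool card_ord. Qed.

Definition signed_sum (V : lmodType K) (s : seq 'I_m) (a : 'I_m -> V) e : V :=
  \sum_(j <- s) sg e j *: a j.

Lemma signed_sum_flip (V : lmodType K) s j (a : 'I_m -> V) e :
  j \notin s -> signed_sum s a (flip j e) = signed_sum s a e.
Proof.
move=> js; apply: eq_big_seq => i si; rewrite ffunE.
by case: eqVneq si js => [->->|_ _ _]//; rewrite addbF.
Qed.

(** The parallelogram law lets one sign at a time be averaged out; the constant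
    5 is what the induction tolerates. *)
Lemma sum_signed_sum_moments (s : seq 'I_m) (a : 'I_m -> K^o) : uniq s ->
  \sum_e rnorm (signed_sum s a e) ^+ 2 = 2 ^+ m * \sum_(j <- s) rnorm (a j) ^+ 2
  /\ \sum_e rnorm (signed_sum s a e) ^+ 4 <=
     5 * 2 ^+ m * (\sum_(j <- s) rnorm (a j) ^+ 2) ^+ 2.
Proof.
elim: s => [|j s IH] /=.
  move=> _; rewrite big_nil; split.
    by rewrite mulr0 big1// => e _; rewrite /signed_sum big_nil rnorm0 expr0n.
  by rewrite expr0n mulr0 big1// => e _; rewrite /signed_sum big_nil rnorm0 expr0n.
case/andP=> js us; have [IH2 IH4] := IH us.
set S := \sum_(j <- s) _ in IH2 IH4 *; rewrite big_cons -/S.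
have cst (c : R) : \sum_(e : {ffun 'I_m -> bool}) c = 2 ^+ m * c.
  by rewrite sumr_const card_signs -natrX mulr_natl.
pose G e : K^o := signed_sum s a e.
have para e : rnorm (signed_sum (j :: s) a e) ^+ 2 +
      rnorm (signed_sum (j :: s) a (flip j e)) ^+ 2 =
      2 * (rnorm (G e) ^+ 2 + rnorm (a j) ^+ 2)
   /\ `|rnorm (signed_sum (j :: s) a e) - rnorm (signed_sum (j :: s) a (flip j e))|
      <= 2 * rnorm (a j).
  rewrite /signed_sum !big_cons -!/(signed_sum s a _) signed_sum_flip//.
  rewrite !ffunE eqxx addbT -/(G e).
  set b : K^o := sg e j *: a j.
  have -> : ((-1) ^+ (~~ e j) : K) *: a j = - b by rewrite /b -scaleNr; case: (e j); rewrite ?opprK.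
  have rb : rnorm b = rnorm (a j).
    by rewrite /b; case: (e j); rewrite ?expr0 ?expr1 ?scale1r// scaleN1r rnormN.
  have := rnorm_parallelogram (G e : K) (b : K); rewrite rb => h.
  rewrite (addrC b) (addrC (- b)); split; first by rewrite -h.
  by rewrite -rb; exact: ler_dist_rnormDB.
split.
  apply: (@mulfI _ 2) => //; rewrite (sum_flip j).
  under eq_bigr do rewrite (para _).1.
  by rewrite -mulr_sumr big_split/= IH2 cst; ring.
rewrite -(@ler_pM2l _ 2)// (sum_flip j).
set r := rnorm (a j).
have r0 : 0 <= r by rewrite rnorm_ge0.
apply: (@le_trans _ _ (\sum_e (2 * rnorm (G e) ^+ 4 + 12 * r ^+ 2 * rnorm (G e) ^+ 2 + 10 * r ^+ 4))).
  apply: ler_sum => e _; have [] := para e.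
  set u := rnorm _; set v := rnorm _; set g := rnorm _; rewrite -/r => h h'.
  have h2 : (u - v) ^+ 2 <= 4 * r ^+ 2.
    by rewrite -real_normK ?num_real// (_ : 4 * _ = (2 * r) ^+ 2) ?lerXn2r ?nnegrE//; [lra|ring].
  have h3 : (u + v) ^+ 2 <= 4 * (g ^+ 2 + r ^+ 2).
    have := sqr_ge0 (u - v); nra.
  have h4 : (u ^+ 2 - v ^+ 2) ^+ 2 <= (4 * r ^+ 2) * (4 * (g ^+ 2 + r ^+ 2)).
    by rewrite subr_sqr exprMn ler_pM ?sqr_ge0.
  have -> : u ^+ 4 + v ^+ 4 = ((u ^+ 2 + v ^+ 2) ^+ 2 + (u ^+ 2 - v ^+ 2) ^+ 2) / 2 by field.
  rewrite h; nra.
rewrite !big_split/= -!mulr_sumr IH2 cst.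
have S0 : 0 <= S by apply: sumr_ge0 => i _; rewrite sqr_ge0.
have p0 : 0 <= 2 ^+ m :> R by rewrite exprn_ge0.
have : 12 * r ^+ 2 * (2 ^+ m * S) <= 20 * r ^+ 2 * (2 ^+ m * S).
  by rewrite ler_wpM2r ?mulr_ge0// ler_wpM2r ?sqr_ge0//; lra.
nra.
Qed.

End Signs.

Section Riesz.
Context {R : realType} {m : nat}.
Implicit Types (e : {ffun 'I_m -> bool}).

Let sqmod (x : complex R) : R := complex.Re x ^+ 2 + complex.Im x ^+ 2.

Let sqmodM : {morph sqmod : x y / x * y}.
Proof. by move=> [a b] [c d]; rewrite /sqmod /=; ring. Qed.

(** The Riesz product [\prod_j (1 + i (-1)^(e j) z j)] has modulus at most
    [exp (1/2)], and [z] is the sequence of the first-order Walsh coefficients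
    of its imaginary part. *)
Lemma bounded_real_walsh_lift (z : 'I_m -> R) : \sum_j z j ^+ 2 <= 1 ->
  exists W : {ffun 'I_m -> bool} -> R,
    (forall e, W e ^+ 2 <= expR 1) /\
    forall j, z j = (2 ^+ m)^-1 * \sum_(e : {ffun 'I_m -> bool}) (-1) ^+ (e j) * W e.
Proof.
move=> z1; pose c (b : bool) i : complex R := (1 +i* ((-1) ^+ b * z i))%C.
pose Z e := \prod_i c (e i) i; exists (fun e => complex.Im (Z e)); split=> [e|j].
  apply: (@le_trans _ _ (sqmod (Z e))); first by rewrite lerDr sqr_ge0.
  rewrite /Z (big_morph sqmod sqmodM (id1 := 1)); last first.
    by rewrite /sqmod /= expr1n expr0n addr0.
  apply: (@le_trans _ _ (expR (\sum_i z i ^+ 2))); last by rewrite ler_expR.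
  rewrite expR_sum; apply: ler_prod => i _; rewrite /sqmod /= exprMn.
  rewrite -exprM mulnC exprM sqrrN !expr1n mul1r.
  by rewrite addr_ge0 ?sqr_ge0//= expR_ge1Dx.
have E : \sum_(e : {ffun 'I_m -> bool}) ((-1) ^+ (e j) * Z e) = ((2 ^+ m)%:C * (0 +i* z j))%C.
  (* Summing each sign separately leaves [2] for [i != j] and [2 i z j] for [j]. *)
  pose F i (b : bool) : complex R := (if i == j then (-1) ^+ b else 1) * c b i.
  transitivity (\sum_(e : {ffun 'I_m -> bool}) \prod_i F i (e i)).
    apply: eq_bigr => e _; rewrite big_split/= (bigD1 j)//= eqxx.
    by rewrite [X in _ * X * _]big1 ?mulr1// => i /negbTE ->.
  rewrite -bigA_distr_bigA.
  transitivity (\prod_(i < m) (2%:R * (if i == j then (0 +i* z j)%C else 1))).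
    apply: eq_bigr => i _; rewrite big_bool /F /c expr1 expr0.
    have [->|_] := eqVneq i j; apply/eqP; rewrite eq_complex /=;
      by apply/andP; split; apply/eqP; ring.
  rewrite big_split/= prodr_const card_ord (bigD1 j)//= eqxx big1 ?mulr1.
    by rewrite rmorphXn rmorphMn rmorph1.
  by move=> i /negbTE ->.
have ImE (e : {ffun 'I_m -> bool}) :
    complex.Im ((-1) ^+ (e j) * Z e) = (-1) ^+ (e j) * complex.Im (Z e).
  by case: (e j); rewrite ?expr1 ?expr0 ?mul1r// !mulN1r raddfN.
have := congr1 (@complex.Im R) E.
rewrite raddf_sum (eq_bigr _ (fun e _ => ImE e)) => ->.
by rewrite /= mul0r addr0 mulKf// expf_neq0.
Qed.
End Riesz.

Section WalshLift.
Context {R : realType} {k : scalars}.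
Local Notation K := (scalar_field R k).

(** Riesz products for the real and imaginary parts, coordinate by coordinate. *)
Lemma bounded_walsh_lift (m N : nat) (x : 'I_m -> 'rV[K]_N) :
  (forall t, \sum_j rnorm (x j 0 t) ^+ 2 <= 1) ->
  exists W : {ffun 'I_m -> bool} -> 'rV[K]_N,
    (forall e t, rnorm (W e 0 t) <= Num.sqrt (2 * expR 1)) /\
    forall j, x j = kemb k (2 ^+ m)^-1 *:
      \sum_(e : {ffun 'I_m -> bool}) ((-1) ^+ (e j) : K) *: W e.
Proof.
move=> x1.
have re1 t : \sum_j scalar_re (x j 0 t) ^+ 2 <= 1.
  apply: le_trans (x1 t); apply: ler_sum => j _.
  by rewrite rnormK lerDl sqr_ge0.
have im1 t : \sum_j kim (x j 0 t) ^+ 2 <= 1.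
  apply: le_trans (x1 t); apply: ler_sum => j _.
  by rewrite rnormK lerDr sqr_ge0.
have [U hU] := choice (fun t => bounded_real_walsh_lift (re1 t)).
have [V hV] := choice (fun t => bounded_real_walsh_lift (im1 t)).
exists (fun e => \row_t (kemb k (U t e) + kI R k * kemb k (V t e))); split.
  move=> e t; rewrite mxE -[leLHS]ger0_norm ?rnorm_ge0// -sqrtr_sqr ler_wsqrtr//.
  apply: (le_trans (sqr_rnorm_kreim_le _ _ _)).
  by have := (hU t).1 e; have := (hV t).1 e; lra.
move=> j; apply/rowP => t; rewrite mxE summxE.
rewrite [LHS]kreimE (hU t).2 (hV t).2 !rmorphM !rmorph_sum /=.
rewrite mulrCA -mulrDr; congr (_ * _); rewrite mulr_sumr -big_split/=.
apply: eq_bigr => e _; rewrite !mxE !rmorphM !rmorphXn !rmorphN1 mulrCA -mulrDr.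
by [].
Qed.
End WalshLift.

(** * The Rademacher functions and the cube of signs *)

Section RademacherIntegral.
Context {R : realType}.
Local Notation mu := (@lebesgue_measure R).

Lemma integral_step_function (N : nat) (f : R -> R) (c : 'I_N -> R) :
  (0 < N)%N -> (forall t, 0 <= f t) -> (forall i, 0 <= c i) ->
  (forall (i : 'I_N) t, i%:R < N%:R * t < i.+1%:R -> f t = c i) ->
  (\int[mu]_(t in `[0, 1]) f t)%R = N%:R^-1 * \sum_i c i.
Proof.
move=> N0 f0 c0 fc.
have N0' : 0 < N%:R :> R by rewrite ltr0n.
(* On [0, 1], [f] is exactly a simple function on the open intervals
   and the points between them, so that its integral can be computed term by term. *)
pose J : finType := ('I_N + 'I_N.+1)%type.
pose A (j : J) : set R := match j with
  | inl i => `]i%:R / N%:R, i.+1%:R / N%:R[%classic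
  | inr i => [set i%:R / N%:R]
  end.
pose d (j : J) : R := match j with inl i => c i | inr i => f (i%:R / N%:R) end.
have d0 j : 0 <= d j by case: j => i /=.
have mA j : measurable (A j : set (g_sigma_algebraType R.-ocitv.-measurable)).
  by case: j => i; [exact: measurable_itv|exact: measurable_set1].
have AD j : A j `<=` `[0, 1]%classic.
  case: j => i t /=; rewrite !in_itv /=.
    move=> /andP[/ltW h1 /ltW h2]; apply/andP; split.
      by rewrite (le_trans _ h1)// divr_ge0.
    by rewrite (le_trans h2)// ler_pdivrMr// mul1r ler_nat.
  by move=> ->; rewrite divr_ge0//= ler_pdivrMr// mul1r ler_nat -ltnS.
have muA j : mu (A j) = (if j is inl _ then N%:R^-1 else 0)%:E.
  case: j => i /=; last exact: lebesgue_measure_set1.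
  rewrite lebesgue_measure_itv /= lte_fin ltr_pM2r ?invr_gt0// ltr_nat ltnSn.
  by rewrite -EFinD -mulrBl -natrB// subSnn mul1r.
have fE t : t \in `[0, 1]%classic -> (f t)%:E = (\sum_(j : J) (d j * \1_(A j) t)%:E)%E.
  rewrite inE /= in_itv /= => /andP[t0 t1].
  rewrite sumEFin; congr (_%:E).
  have Nt0 : 0 <= N%:R * t by rewrite mulr_ge0// ltW.
  have NtN : N%:R * t <= N%:R by rewrite ler_piMr// ltW.
  have /andP[h1 h2] := truncn_itv Nt0; set l := Num.truncn _ in h1 h2.
  have lN : (l <= N)%N by rewrite -(ler_nat R) (le_trans h1).
  have inA (i : 'I_N) : (t \in A (inl i)) = (i%:R < N%:R * t < i.+1%:R).
    by apply/idP/idP; rewrite inE /= in_itv /= ltr_pdivrMr// ltr_pdivlMr// [t * _]mulrC.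
  have inB (i : 'I_N.+1) : (t \in A (inr i)) = (N%:R * t == i%:R).
    apply/idP/idP => [|/eqP e].
      by rewrite inE /= => ->; rewrite mulrCA mulfV ?mulr1// gt_eqF.
    by rewrite inE /= -e mulrAC mulfV ?mul1r// gt_eqF.
  have [e|ne] := eqVneq (N%:R * t) l%:R.
    have lN1 : (l < N.+1)%N by rewrite ltnS.
    rewrite (bigD1 (inr (Ordinal lN1)))// big1.
      rewrite indicE inB e eqxx mulr1 /= addr0; congr f.
      by rewrite /= -e mulrAC mulfV ?mul1r// gt_eqF.
    move=> -[i _|i il]; rewrite indicE ?inA ?inB e.
      by rewrite !ltr_nat ltnS; case: ltnP => _; rewrite ?andbF; exact: mulr0.
    rewrite eqr_nat; have [li|_] := eqVneq l i; last exact: mulr0.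
    by case/eqP: il; congr inr; apply/val_inj.
  have {}h1 : l%:R < N%:R * t by rewrite lt_neqAle eq_sym ne.
  have {}lN : (l < N)%N by rewrite -(ltr_nat R) (lt_le_trans h1).
  rewrite (bigD1 (inl (Ordinal lN)))// big1.
    rewrite indicE inA h1 h2 mulr1 /= addr0; by apply: fc; rewrite /= h1 h2.
  move=> -[i il|i _]; rewrite indicE ?inA ?inB.
    case: andP => [[h3 h4]|]; last by move=> *; exact: mulr0.
    have := lt_trans h1 h4; have := lt_trans h3 h2; rewrite !ltr_nat !ltnS => a b.
    by case/eqP: il; congr inl; apply/val_inj/eqP; rewrite eqn_leq a b.
  case: eqVneq => [e|]; last by move=> *; exact: mulr0.
  by move: h1 h2; rewrite e !ltr_nat ltnS => a b; rewrite leqNgt a in b.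
rewrite /Rintegral.
have -> : (\int[mu]_(t in `[0%R, 1%R]) (f t)%:E =
    \int[mu]_(t in `[0%R, 1%R]) \sum_(j : J) (d j * \1_(A j) t)%:E)%E.
  by apply: eq_integral.
have m1 : measurable (`[0, 1]%classic : set (g_sigma_algebraType R.-ocitv.-measurable)) by exact: measurable_itv.
rewrite (@ge0_integral_sum _ _ _ mu _ m1 J (fun j t => (d j * \1_(A j) t)%:E)); last 2 first.
- move=> j; apply/measurable_EFinP; exact: measurable_funM.
- by move=> j t _; rewrite lee_fin mulr_ge0.
rewrite (eq_bigr (fun j => (d j * (if j is inl _ then N%:R^-1 else 0))%:E)).
  rewrite sumEFin /= big_sumType /= [X in _ + X]big1 ?addr0; last first.
    by move=> i _; rewrite mulr0.
  by rewrite -mulr_suml mulrC.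
move=> j _; under eq_integral do rewrite EFinM.
rewrite (ge0_integralZl_EFin _ m1) //=; last first.
  by apply/measurable_EFinP; exact: (measurable_indic (mA j)).
rewrite integral_indic; [|exact: m1|exact: mA].
rewrite (setIidl (@AD j)) EFinM; congr (_ * _)%E; exact: muA.
Qed.

Lemma sgz_sin_pi (d : nat) (s : R) : d%:R < s < d.+1%:R ->
  sgz (sin (pi * s)) = (-1) ^+ odd d.
Proof.
move=> /andP[ds sd].
have -> : pi * s = pi * (s - d%:R) + pi *+ d by rewrite -mulr_natr; ring.
rewrite (alternatingn (@sinDpi R)) signr_odd sgzM.
have sd1 : s - d%:R < 1 by move: sd; rewrite -natr1; lra.
have -> : sgz (sin (pi * (s - d%:R))) = 1.
  apply/eqP; rewrite sgz_cp0 sin_gt0_pi// mulr_gt0 ?pi_gt0 ?subr_gt0//=.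
  by rewrite gtr_pMr ?pi_gt0.
by rewrite mulr1 sgzX sgzN1.
Qed.

(** The signs of the first [m] Rademacher functions on the [k]-th dyadic interval
    of length [2 ^- m]: the binary digits of [k], the leading one first. *)
Definition dyadic_signs (m k : nat) : {ffun 'I_m -> bool} :=
  [ffun j : 'I_m => odd (k %/ 2 ^ (m - j.+1))].

Lemma rademacher_dyadic (m k : nat) (j : 'I_m) (t : R) :
  k%:R < (2 ^ m)%:R * t < k.+1%:R ->
  rademacher j.+1 t = (-1) ^+ dyadic_signs m k j.
Proof.
move=> /andP[kt tk]; rewrite /rademacher ffunE.
rewrite -mulrA mulrCA; apply: sgz_sin_pi.
set p := (2 ^ (m - j.+1))%N.
have p0 : (0 < p)%N by rewrite expn_gt0.
have p0' : 0 < p%:R :> R by rewrite ltr0n.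
have E : (2 ^ m)%:R * t = p%:R * (2 ^+ j.+1 * t).
  by rewrite mulrA /p !natrX -exprD subnK.
rewrite E in kt tk; apply/andP; split.
  rewrite -(ltr_pM2l p0') (le_lt_trans _ kt)// -natrM ler_nat mulnC.
  exact: leq_trunc_div.
rewrite -(ltr_pM2l p0') (lt_le_trans tk)// -natrM ler_nat mulnC.
by rewrite -ltn_divLR.
Qed.

Lemma dyadic_signs_inj (m k l : nat) : (k < 2 ^ m)%N -> (l < 2 ^ m)%N ->
  dyadic_signs m k = dyadic_signs m l -> k = l.
Proof.
move=> km lm E.
have {E} : forall i, (i < m)%N -> odd (k %/ 2 ^ i) = odd (l %/ 2 ^ i).
  move=> i im; have jm : (m - i.+1 < m)%N by rewrite ltn_subrL/= (leq_trans _ im).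
  have := congr1 (fun f : {ffun 'I_m -> bool} => f (Ordinal jm)) E.
  by rewrite !ffunE /= subnSK// subKn// ltnW.
elim: m k l km lm => [|m IH] k l; first by rewrite expn0 !ltnS !leqn0 => /eqP-> /eqP->.
rewrite expnS !mul2n => km lm E.
have := E 0 isT; rewrite expn0 !divn1 => E0.
rewrite -(odd_double_half k) -(odd_double_half l) E0; congr (_ + _.*2)%N.
apply: IH => [||i im].
- by rewrite ltn_half_double.
- by rewrite ltn_half_double.
- by have := E i.+1 im; rewrite expnS !divnMA !divn2.
Qed.

End RademacherIntegral.

Section RademacherAverage.
Context {R : realType} {k : scalars}.
Local Notation K := (scalar_field R k).
Context {F : normedModType K}.

Lemma sqr_rademacher_average (m : nat) (x : 'I_m -> F) :
  rademacher_average x ^+ 2 =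
  (2 ^+ m)^-1 * \sum_(e : {ffun 'I_m -> bool})
    rnorm (\sum_j ((-1) ^+ (e j) : K) *: x j) ^+ 2.
Proof.
pose g (e : {ffun 'I_m -> bool}) :=
  rnorm (\sum_j ((-1) ^+ (e j) : K) *: x j) ^+ 2.
pose c (i : 'I_(2 ^ m)) := g (dyadic_signs m i).
rewrite /rademacher_average (@integral_step_function _ (2 ^ m) _ c) ?expn_gt0//.
- rewrite sqr_sqrtr; last by rewrite mulr_ge0// sumr_ge0// => i _; exact: sqr_ge0.
  rewrite natrX; congr (_ * _); rewrite /c.
  have inj : injective (fun i : 'I_(2 ^ m) => dyadic_signs m i).
    by move=> i l /dyadic_signs_inj h; apply/val_inj/h.
  rewrite [RHS](reindex (fun i : 'I_(2 ^ m) => dyadic_signs m i))//.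
  by apply: onW_bij; apply: inj_card_bij => //; rewrite card_ord card_signs.
- by move=> t; exact: sqr_ge0.
- by move=> i; exact: sqr_ge0.
- move=> i t it; congr (rnorm _ ^+ 2); apply: eq_bigr => j _.
  rewrite (rademacher_dyadic j it); case: (dyadic_signs m i j).
    by rewrite !expr1 scaleN1r mulrN1z.
  by rewrite !expr0 scale1r.
Qed.

End RademacherAverage.

(** * Cotype in terms of finitely many signs *)

Section CotypeSigns.
Context {R : realType} {k : scalars}.
Local Notation K := (scalar_field R k).
Context {F : normedModType K}.

Lemma cotype2_signs (C : R) :
  (forall m (x : 'I_m -> F), lq_norm 2%:E x <= C * rademacher_average x) ->
  forall m (x : 'I_m -> F), \sum_j rnorm (x j) ^+ 2 <=
    C ^+ 2 * ((2 ^+ m)^-1 * \sum_(e : {ffun 'I_m -> bool})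
      rnorm (\sum_j ((-1) ^+ (e j) : K) *: x j) ^+ 2).
Proof.
move=> hC m x; rewrite -sqr_rademacher_average -exprMn.
have -> : \sum_j rnorm (x j) ^+ 2 = lq_norm 2%:E x ^+ 2.
  rewrite /= -powR_mulrn ?powR_ge0// -powRrM mulVf// powRr1.
    by apply: eq_bigr => j _; rewrite powR_mulrn ?rnorm_ge0.
  by apply: sumr_ge0 => j _; exact: powR_ge0.
by rewrite lerXn2r ?nnegrE ?powR_ge0// (le_trans _ (hC m x))// powR_ge0.
Qed.

Lemma cotype_sup_signs (C q : R) : 0 <= C -> 0 < q ->
  (forall m (x : 'I_m -> F), lq_norm q%:E x <= C * rademacher_average x) ->
  forall (I : finType) (x : I -> F) (c : R),
    (forall e : I -> bool, rnorm (\sum_i ((-1) ^+ (e i) : K) *: x i) <= c) ->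
    \sum_i rnorm (x i) `^ q <= (C * c) `^ q.
Proof.
move=> C0 q0 hC I x c hc.
pose y (j : 'I_#|I|) := x (enum_val j).
have c0 : 0 <= c by apply: le_trans (hc (fun=> true)); exact: rnorm_ge0.
have avg : rademacher_average y <= c.
  rewrite -(@ler_pXn2r _ 2) ?nnegrE ?sqrtr_ge0// sqr_rademacher_average.
  rewrite ler_pdivrMl ?exprn_gt0//.
  apply: (@le_trans _ _ (\sum_(e : {ffun 'I_#|I| -> bool}) c ^+ 2)).
    apply: ler_sum => e _; rewrite lerXn2r ?nnegrE ?rnorm_ge0//.
    have := hc (fun i => e (enum_rank i)).
    rewrite (reindex (@enum_val I predT)) /=; last exact/onW_bij/enum_val_bij.
    by under eq_bigr do rewrite enum_valK.
  by rewrite sumr_const card_signs -natrX mulr_natl.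
have -> : \sum_i rnorm (x i) `^ q = lq_norm q%:E y `^ q.
  rewrite /= -powRrM mulVf ?gt_eqF// powRr1; last first.
    by apply: sumr_ge0 => j _; exact: powR_ge0.
  by rewrite (reindex (@enum_val I predT)) //=; exact/onW_bij/enum_val_bij.
rewrite ge0_ler_powR ?nnegrE ?powR_ge0 ?mulr_ge0//; first exact: ltW.
by rewrite (le_trans (hC _ y))// ler_wpM2l.
Qed.

End CotypeSigns.

(** * Operators from finite-dimensional sup-normed spaces *)

Section SupContraction.
Context {R : realType} {k : scalars}.
Local Notation K := (scalar_field R k).
Context {F : normedModType K} {N : nat}.

Definition sup_contraction (S : 'rV[K]_N -> F) :=
  forall y : 'rV[K]_N, (forall t, rnorm (y 0 t) <= 1) -> rnorm (S y) <= 1.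

Definition restrict_coords (B : pred 'I_N) (y : 'rV[K]_N) : 'rV[K]_N :=
  \row_t (if B t then y 0 t else 0).

Lemma restrict_coords_split B y : y = restrict_coords B y + restrict_coords (predC B) y.
Proof. by apply/rowP => t; rewrite !mxE /=; case: (B t); rewrite ?addr0 ?add0r. Qed.

Lemma rnorm_restrict_coords B y t : rnorm (restrict_coords B y 0 t) <= rnorm (y 0 t).
Proof. by rewrite mxE; case: ifP => // _; rewrite rnorm0 rnorm_ge0. Qed.

Context (S : {linear 'rV[K]_N -> F}) (S1 : sup_contraction S).

Lemma sup_contraction_le (c : R) (y : 'rV[K]_N) : 0 <= c ->
  (forall t, rnorm (y 0 t) <= c) -> rnorm (S y) <= c.
Proof.
rewrite le_eqVlt => /predU1P[<-|c0] yc.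
  rewrite (_ : y = 0) ?linear0 ?rnorm0//; apply/rowP => t; rewrite !mxE.
  by apply: rnorm_eq0; apply/eqP; rewrite eq_le yc rnorm_ge0.
have := S1 (y := kemb k c^-1 *: y).
rewrite linearZ /= rnormZ rnorm_kemb gtr0_norm ?invr_gt0//.
rewrite ler_pdivrMl// mulr1; apply => t.
by rewrite mxE rnormM rnorm_kemb gtr0_norm ?invr_gt0// ler_pdivrMl// mulr1.
Qed.

Lemma sup_contraction_sqr_le (y : 'rV[K]_N) :
  rnorm (S y) ^+ 2 <= \sum_t rnorm (y 0 t) ^+ 2.
Proof.
have s0 : 0 <= \sum_t rnorm (y 0 t) ^+ 2 by apply: sumr_ge0 => t _; exact: sqr_ge0.
rewrite -[leRHS]sqr_sqrtr// lerXn2r ?nnegrE ?rnorm_ge0 ?sqrtr_ge0//.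
apply: sup_contraction_le => [|t]; first exact: sqrtr_ge0.
rewrite -[leLHS]ger0_norm ?rnorm_ge0// -sqrtr_sqr ler_wsqrtr//.
by rewrite (bigD1 t)//= lerDl sumr_ge0// => i _; exact: sqr_ge0.
Qed.

End SupContraction.

Section CotypeTwo.
Context {R : realType} {k : scalars}.
Local Notation K := (scalar_field R k).
Context {F : normedModType K} (C : R).
Context (hC : forall m (x : 'I_m -> F), lq_norm 2%:E x <= C * rademacher_average x).

(** Cotype 2 bounds [\sum_j ||S x_j||^2] by the mean of [||S G||^2], where
    [G = \sum_j +- x_j]. Where [|G|] is at most [sqrt L], the contraction [S]
    is bounded by [sqrt L]; the remaining part of [G] is, by the fourth moment
    bound, a weakly square-summable family over the cube with constant
    [O (1 / L)], to which the best constant [A] applies again. *)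
Lemma cotype2_sup_contraction_summing : exists D : R,
  forall N (S : {linear 'rV[K]_N -> F}), sup_contraction S ->
  forall m (x : 'I_m -> 'rV[K]_N),
    (forall t, \sum_j rnorm (x j 0 t) ^+ 2 <= 1) ->
    \sum_j rnorm (S (x j)) ^+ 2 <= D.
Proof.
(* In the final estimate [A] is multiplied by [10 * C ^+ 2 / L < 1 / 2]. *)
pose L : R := 20 * C ^+ 2 + 1.
have L0 : 0 < L by rewrite ltr_pwDr// mulr_ge0// sqr_ge0.
exists (2 * (2 * C ^+ 2 * L)) => N S S1 m0 x0 x01.
pose P : set R := [set v | exists m (x : 'I_m -> 'rV[K]_N),
  (forall t, \sum_j rnorm (x j 0 t) ^+ 2 <= 1) /\
  v = \sum_j rnorm (S (x j)) ^+ 2].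
apply: (@self_improving_bound _ P N%:R); last by exists m0, x0.
  move=> _ [m [x [x1 ->]]].
  apply: (@le_trans _ _ (\sum_j \sum_t rnorm (x j 0 t) ^+ 2)).
    by apply: ler_sum => j _; exact: sup_contraction_sqr_le.
  rewrite exchange_big /= (le_trans (ler_sum _ (fun t _ => x1 t)))//.
  by rewrite sumr_const card_ord.
move=> A PA _ [m [x [x1 ->]]] {m0 x0 x01}.
pose cube : finType := {ffun 'I_m -> bool}.
pose G (e : {ffun 'I_m -> bool}) := \sum_j ((-1) ^+ (e j) : K) *: x j.
pose B (e : cube) t := rnorm (G e 0 t) ^+ 2 <= L.
pose Rm (e : cube) := restrict_coords (predC (B e)) (G e).
have p0 : 0 < 2 ^+ m :> R by rewrite exprn_gt0.
have GE (e : cube) t : G e 0 t =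
    signed_sum (index_enum 'I_m) (fun j => x j 0 t : K^o) e.
  by rewrite /G summxE; apply: eq_bigr => j _; rewrite mxE.
have tail t : \sum_e rnorm (Rm e 0 t) ^+ 2 <= 5 * 2 ^+ m / L.
  have [_] := sum_signed_sum_moments (fun j => x j 0 t : K^o) (index_enum_uniq 'I_m).
  move=> h; rewrite ler_pdivlMr// mulr_suml.
  apply: (@le_trans _ _ (\sum_e rnorm (G e 0 t) ^+ 4)).
    apply: ler_sum => e _; rewrite mxE /=; case: ifPn => [|_].
      rewrite -ltNge => /ltW LG; rewrite (_ : _ ^+ 4 = rnorm (G e 0 t) ^+ 2 * rnorm (G e 0 t) ^+ 2); last by ring.
      by rewrite ler_wpM2l ?sqr_ge0.
    by rewrite rnorm0 expr0n mul0r exprn_ge0 ?rnorm_ge0.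
  under eq_bigr do rewrite GE.
  rewrite (le_trans h)// ler_piMr ?mulr_ge0 ?(ltW p0)//.
  by rewrite expr_le1// sumr_ge0// => j _; exact: sqr_ge0.
have remainder : (2 ^+ m)^-1 * \sum_e rnorm (S (Rm e)) ^+ 2 <= 5 / L * A.
  (* The scaling that makes [Rm] an admissible family indexed by the cube. *)
  pose s := Num.sqrt (L / (5 * 2 ^+ m)).
  have s2 : s ^+ 2 = L / (5 * 2 ^+ m).
    by rewrite sqr_sqrtr// divr_ge0 ?(ltW L0)// mulr_ge0 ?(ltW p0).
  pose y (i : 'I_#|cube|) := kemb k s *: Rm (@enum_val cube predT i).
  have reenum (f : cube -> R) : \sum_(i < #|cube|) f (@enum_val cube predT i) = \sum_e f e.
    rewrite [RHS](reindex (@enum_val cube predT)) //.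
    exact/onW_bij/enum_val_bij.
  have : \sum_i rnorm (S (y i)) ^+ 2 <= A.
    apply: PA; exists #|cube|, y; split=> // t.
    rewrite (reenum (fun e => rnorm ((kemb k s *: Rm e) 0 t) ^+ 2)).
    under eq_bigr do rewrite mxE rnormM exprMn rnorm_kemb real_normK ?num_real//.
    rewrite -mulr_sumr s2 mulrC -ler_pdivlMr ?divr_gt0 ?mulr_gt0//.
    by rewrite invf_div mul1r.
  rewrite (reenum (fun e => rnorm (S (kemb k s *: Rm e)) ^+ 2)).
  under eq_bigr do rewrite linearZ rnormZ exprMn rnorm_kemb real_normK ?num_real//.
  rewrite -mulr_sumr s2 => h; rewrite -[leRHS]mulrC -ler_pdivrMr ?divr_gt0// invf_div.
  apply: le_trans h; rewrite le_eqVlt; apply/orP; left; apply/eqP; field.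
  by rewrite !gt_eqF.
apply: (le_trans (cotype2_signs hC _)).
apply: (@le_trans _ _ (C ^+ 2 * (2 * L + 2 * (5 / L * A)))).
  rewrite ler_wpM2l ?sqr_ge0//.
  apply: (@le_trans _ _ ((2 ^+ m)^-1 * \sum_(e : cube) (2 * L + 2 * rnorm (S (Rm e)) ^+ 2))).
    rewrite ler_pM2l ?invr_gt0//; apply: ler_sum => e _.
    have -> : \sum_j ((-1) ^+ (e j) : K) *: S (x j) = S (G e).
      by rewrite linear_sum; apply: eq_bigr => j _; rewrite linearZ.
    rewrite (restrict_coords_split (B e) (G e)) linearD.
    set a := S _; have := ler_rnormD a (S (Rm e)).
    have : rnorm a <= Num.sqrt L.
      apply: sup_contraction_le => [//||t]; rewrite ?sqrtr_ge0//.
      rewrite mxE; case: ifPn => [|_]; last by rewrite rnorm0 sqrtr_ge0.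
      by move=> h; rewrite -[leLHS]ger0_norm ?rnorm_ge0// -sqrtr_sqr ler_wsqrtr.
    have := rnorm_ge0 a; have := rnorm_ge0 (S (Rm e)).
    have := rnorm_ge0 (a + S (Rm e)); have := sqr_sqrtr (ltW L0).
    have := sqrtr_ge0 L.
    set u := rnorm (a + _); set v := rnorm a; set w := rnorm (S (Rm e)).
    set l := Num.sqrt _ => l0 <- u0 w0 v0 vl uvw.
    apply: (@le_trans _ _ ((v + w) ^+ 2)); first by rewrite lerXn2r ?nnegrE ?addr_ge0.
    by have := sqr_ge0 (v - w); nra.
  rewrite big_split/= mulrDr.
  have -> : \sum_(e : cube) 2 * L = 2 ^+ m * (2 * L).
    by rewrite sumr_const card_signs -natrX [RHS]mulr_natl.
  by rewrite -mulr_sumr mulKf ?gt_eqF// lerD2l mulrCA ler_pM2l.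
have A0 : 0 <= A.
  by apply: PA; exists 0%N, (fun=> 0); split=> [t|]; rewrite big_ord0.
have : C ^+ 2 * 10 / L * A <= A / 2.
  rewrite mulrC ler_wpM2l// ler_pdivrMr// /L; lra.
have -> : C ^+ 2 * (2 * L + 2 * (5 / L * A)) = 2 * C ^+ 2 * L + C ^+ 2 * 10 / L * A by ring.
lra.
Qed.

End CotypeTwo.

(** * Bernoulli selections *)

Section Bernoulli.
Context {R : realType} {I : finType} (w : I -> R).
Implicit Types (f : {ffun I -> bool}).

Definition bernoulli_weight f : R := \prod_i (if f i then w i else 1 - w i).

Lemma bernoulli_weight_ge0 f : (forall i, 0 <= w i <= 1) -> 0 <= bernoulli_weight f.
Proof.
move=> w01; apply: prodr_ge0 => i _; have /andP[w0 w1] := w01 i.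
by case: (f i); rewrite ?subr_ge0.
Qed.

Lemma bernoulli_weight_le1 f : (forall i, 0 <= w i <= 1) -> bernoulli_weight f <= 1.
Proof.
move=> w01; apply: prodr_ile1 => i _; have /andP[w0 w1] := w01 i.
by case: (f i); rewrite ?w0 ?w1// subr_ge0 w1 gerBl.
Qed.

Lemma bernoulli_mean_prod (A : pred I) :
  \sum_(f : {ffun I -> bool}) bernoulli_weight f * \prod_(i | A i) (f i)%:R = \prod_(i | A i) w i.
Proof.
pose h i (b : bool) : R := (if b then w i else 1 - w i) * (if A i then b%:R else 1).
transitivity (\sum_(f : {ffun I -> bool}) \prod_i h i (f i)).
  apply: eq_bigr => f _.
  by rewrite /bernoulli_weight [X in _ * X]big_mkcond -big_split.
rewrite -bigA_distr_bigA [RHS]big_mkcond; apply: eq_bigr => i _.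
by rewrite big_bool /h; case: (A i) => /=; rewrite ?mulr1n ?mulr0n; ring.
Qed.

Lemma bernoulli_total : \sum_(f : {ffun I -> bool}) bernoulli_weight f = 1.
Proof.
have := bernoulli_mean_prod pred0; rewrite big_pred0_eq => <-.
by apply: eq_bigr => f _; rewrite big_pred0_eq mulr1.
Qed.

Lemma bernoulli_mean (c : I -> R) :
  \sum_(f : {ffun I -> bool}) bernoulli_weight f * \sum_i (f i)%:R * c i = \sum_i w i * c i.
Proof.
under eq_bigr do rewrite mulr_sumr.
rewrite exchange_big /=; apply: eq_bigr => i _.
under eq_bigr do rewrite mulrA.
rewrite -mulr_suml; congr (_ * _).
have := bernoulli_mean_prod (pred1 i); rewrite big_pred1_eq => <-.
by apply: eq_bigr => f _; rewrite big_pred1_eq.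
Qed.

Lemma bernoulli_second_moment (c : I -> R) :
  (forall i, 0 <= w i) -> (forall i, 0 <= c i) ->
  \sum_(f : {ffun I -> bool}) bernoulli_weight f * (\sum_i (f i)%:R * c i) ^+ 2 <=
  \sum_i w i * c i ^+ 2 + (\sum_i w i * c i) ^+ 2.
Proof.
move=> w0 c0.
have cross i j : \sum_(f : {ffun I -> bool}) bernoulli_weight f * ((f i)%:R * (f j)%:R) <=
    (if i == j then w i else 0) + w i * w j.
  have [<-|ij] := eqVneq i j.
    apply: (@le_trans _ _ (w i)); last by rewrite lerDl mulr_ge0.
    have := bernoulli_mean_prod (pred1 i); rewrite big_pred1_eq => <-.
    rewrite le_eqVlt; apply/orP; left.
    apply/eqP/eq_bigr => f _; rewrite big_pred1_eq; congr (_ * _).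
    by case: (f i); rewrite ?mulr1 ?mulr0.
  rewrite add0r le_eqVlt; apply/orP; left; apply/eqP.
  have := bernoulli_mean_prod (pred2 i j).
  have E (g : I -> R) : \prod_(l | pred2 i j l) g l = g i * g j.
    rewrite (bigD1 i) /= ?eqxx// (big_pred1 j)// => l /=.
    by have [->|_] := eqVneq l i; rewrite ?(negbTE ij) ?andbF ?andbT.
  by rewrite E => <-; apply: eq_bigr => f _; rewrite E.
have sq (g : I -> R) : (\sum_i g i) ^+ 2 = \sum_i \sum_j g i * g j.
  by rewrite expr2 mulr_suml; apply: eq_bigr => i _; rewrite mulr_sumr.
apply: (@le_trans _ _ (\sum_i \sum_j c i * c j *
    \sum_(f : {ffun I -> bool}) bernoulli_weight f * ((f i)%:R * (f j)%:R))).
  rewrite le_eqVlt; apply/orP; left; apply/eqP.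
  under eq_bigr do rewrite sq mulr_sumr.
  rewrite exchange_big /=; apply: eq_bigr => i _.
  under eq_bigr do rewrite mulr_sumr.
  rewrite exchange_big /=; apply: eq_bigr => j _.
  by rewrite mulr_sumr; apply: eq_bigr => f _; ring.
apply: (@le_trans _ _ (\sum_i \sum_j
    ((if i == j then w i else 0) * (c i * c j) + (w i * c i) * (w j * c j)))).
  apply: ler_sum => i _; apply: ler_sum => j _.
  rewrite (_ : _ + _ = c i * c j * ((if i == j then w i else 0) + w i * w j)); last by ring.
  by rewrite ler_wpM2l// mulr_ge0.
rewrite sq -big_split/= ler_sum// => i _; rewrite big_split/= lerD2r.
rewrite (bigD1 i)//= eqxx big1 ?addr0// => j /negbTE ji.
by rewrite eq_sym ji mul0r.
Qed.

End Bernoulli.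

Section CotypeLarge.
Context {R : realType} {k : scalars}.
Local Notation K := (scalar_field R k).
Context {F : normedModType K} (C q : R).
Context (C0 : 0 <= C) (q2 : 2 < q).
Context (hC : forall m (x : 'I_m -> F), lq_norm q%:E x <= C * rademacher_average x).

Let q0 : 0 < q. Proof. by move: q2; lra. Qed.

(** With weights 1 these are the weakly square-summable families. Weights are
    there because the parts of a family left over by a random selection, weighted
    by the probabilities of the selections, form again such a family. *)
Definition weighted_family N (I : finType) (w : I -> R) (x : I -> 'rV[K]_N) :=
  [/\ forall i, 0 <= w i <= 1, forall i t, rnorm (x i 0 t) <= 1 &
      forall t, \sum_i w i * rnorm (x i 0 t) ^+ 2 <= 1].

Definition weighted_sum N (S : 'rV[K]_N -> F) (I : finType) (w : I -> R)
  (x : I -> 'rV[K]_N) : R := \sum_i w i * rnorm (S (x i)) `^ q.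

Section Operator.
Context {N : nat} (S : {linear 'rV[K]_N -> F}) (S1 : sup_contraction S).

Lemma weighted_sum_le_dim (I : finType) (w : I -> R) (x : I -> 'rV[K]_N) :
  weighted_family w x -> weighted_sum S w x <= N%:R.
Proof.
move=> [w01 x1 wx].
apply: (@le_trans _ _ (\sum_i w i * \sum_t rnorm (x i 0 t) ^+ 2)).
  apply: ler_sum => i _; have /andP[w0 _] := w01 i; rewrite ler_wpM2l//.
  apply: le_trans (sup_contraction_sqr_le S1 _).
  have [->|n0] := eqVneq (rnorm (S (x i))) 0.
    by rewrite powR0 ?gt_eqF// expr0n.
  rewrite -powR_mulrn ?rnorm_ge0// ger_powR ?(ltW q2)//.
  by rewrite lt_neqAle eq_sym n0 rnorm_ge0 S1.
under eq_bigr do rewrite mulr_sumr.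
rewrite exchange_big /= (le_trans (ler_sum _ (fun t _ => wx t)))//.
by rewrite sumr_const card_ord.
Qed.

Context (A : R).
Context (hA : forall (I : finType) (w : I -> R) (x : I -> 'rV[K]_N),
  weighted_family w x -> weighted_sum S w x <= A).

(** Entries of modulus at most [eta] are rescaled by [eta^-1] and their weights
    by [eta ^+ 2]: since [q > 2] this gains the factor [eta `^ (q - 2)]. *)
Lemma weighted_sum_small (eta : R) (I : finType) (w : I -> R) (x : I -> 'rV[K]_N) :
  0 < eta -> eta <= 1 -> weighted_family w x ->
  (forall i t, rnorm (x i 0 t) <= eta) ->
  weighted_sum S w x <= eta `^ (q - 2) * A.
Proof.
move=> e0 e1 [w01 x1 wx] xe.
pose y i := kemb k eta^-1 *: x i.
have yE i t : rnorm (y i 0 t) = eta^-1 * rnorm (x i 0 t).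
  by rewrite mxE rnormM rnorm_kemb gtr0_norm ?invr_gt0.
have /hA : weighted_family (fun i => eta ^+ 2 * w i) y.
  split=> [i|i t|t].
  - have /andP[w0 w1] := w01 i; rewrite mulr_ge0 ?sqr_ge0//=.
    by rewrite mulr_ile1 ?sqr_ge0// expr_le1// ltW.
  - by rewrite yE ler_pdivrMl// mulr1.
  - apply: le_trans (wx t); rewrite le_eqVlt; apply/orP; left; apply/eqP.
    by apply: eq_bigr => i _; rewrite yE; field; rewrite gt_eqF.
have -> : weighted_sum S (fun i => eta ^+ 2 * w i) y =
    eta^-1 `^ q * eta ^+ 2 * weighted_sum S w x.
  rewrite /weighted_sum mulr_sumr; apply: eq_bigr => i _.
  rewrite linearZ rnormZ rnorm_kemb gtr0_norm ?invr_gt0//.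
  by rewrite powRM ?invr_ge0 ?(ltW e0) ?rnorm_ge0//; ring.
have E : eta^-1 `^ q * eta ^+ 2 = (eta `^ (q - 2))^-1.
  rewrite -[RHS]powRN -powR_inv1 ?(ltW e0)// -powRrM mulN1r.
  rewrite -powR_mulrn ?(ltW e0)// -powRD; last by rewrite (gt_eqF e0) implybT.
  by congr (_ `^ _); ring.
by rewrite E ler_pdivrMl ?powR_gt0.
Qed.

(** The case of large entries. Selecting [i] with probability [w i], the
    selected entries at a coordinate have a sum [T] with [E T ^ 2 <= 1 + eta^-2].
    On the coordinates with [T <= M] cotype applies to any signs; the others
    carry, on average, so little mass that [n0] copies of them still form an
    admissible weighted family. *)
Lemma weighted_sum_large (eta : R) (n0 : nat) (I : finType) (w : I -> R)
    (x : I -> 'rV[K]_N) :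
  0 < eta -> (0 < n0)%N -> weighted_family w x ->
  (forall i t, rnorm (x i 0 t) = 0 \/ eta <= rnorm (x i 0 t)) ->
  weighted_sum S w x <=
    2 `^ q * ((C * (n0%:R * (1 + eta^-1 ^+ 2))) `^ q + A / n0%:R).
Proof.
move=> e0 n00 [w01 x1 wx] xe.
have n00' : 0 < n0%:R :> R by rewrite ltr0n.
set M := n0%:R * _.
have M0 : 0 < M by rewrite mulr_gt0// ltr_pwDl// sqr_ge0.
have w0 i : 0 <= w i by have /andP[] := w01 i.
pose cube : finType := {ffun I -> bool}.
pose P (f : cube) := bernoulli_weight w f.
have P0 (f : cube) : 0 <= P f by exact: bernoulli_weight_ge0.
pose T (f : cube) t := \sum_i (f i)%:R * rnorm (x i 0 t).
have T0 f t : 0 <= T f t by apply: sumr_ge0 => i _; rewrite mulr_ge0 ?rnorm_ge0.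
pose B f t := T f t <= M.
pose lo f i := restrict_coords (B f) (x i).
pose hi f i := restrict_coords (predC (B f)) (x i).
have low (f : cube) : \sum_i (f i)%:R * rnorm (S (lo f i)) `^ q <= (C * M) `^ q.
  apply: (@le_trans _ _ (\sum_i rnorm ((f i)%:R *: S (lo f i)) `^ q)).
    apply: ler_sum => i _; case: (f i); first by rewrite mul1r scale1r.
    by rewrite mul0r scale0r powR_ge0.
  apply: (cotype_sup_signs C0 q0 hC) => e.
  have -> : \sum_i ((-1) ^+ (e i) : K) *: ((f i)%:R *: S (lo f i)) =
      S (\sum_i ((-1) ^+ (e i) : K) *: ((f i)%:R *: lo f i)).
    have SZ (a : K) y : S (a *: y) = a *: S y by rewrite linearZ.
    by rewrite linear_sum; apply: eq_bigr => i _; rewrite !SZ.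
  apply: (sup_contraction_le S1) => [|t]; first exact: ltW.
  rewrite summxE (le_trans (ler_rnorm_sum _ _))//.
  have [Bt|Bt] := boolP (B f t); last first.
    rewrite big1 ?(ltW M0)// => i _; rewrite !mxE (negbTE Bt) !mulr0.
    exact: rnorm0.
  apply: le_trans (Bt); apply: ler_sum => i _; rewrite !mxE Bt !rnormM.
  by rewrite rnorm_sign rnorm_nat mul1r.
have tail t : \sum_(f : cube) P f * \sum_i (f i)%:R * rnorm (hi f i 0 t) ^+ 2 <= n0%:R^-1.
  apply: (@le_trans _ _ (\sum_(f : cube) P f * (T f t ^+ 2 / M))).
    apply: ler_sum => f _; rewrite ler_wpM2l//.
    have [Bt|Bt] := boolP (B f t).
      rewrite big1 ?divr_ge0 ?sqr_ge0 ?(ltW M0)// => i _.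
      by rewrite mxE /= Bt rnorm0 expr0n mulr0.
    apply: (@le_trans _ _ (T f t)); last first.
      by rewrite ler_pdivlMr// expr2 ler_wpM2l// ltW// ltNge.
    apply: ler_sum => i _; rewrite ler_wpM2l// mxE /= Bt.
    by rewrite expr2 ler_piMr ?rnorm_ge0.
  under eq_bigr do rewrite mulrA.
  rewrite -mulr_suml ler_pdivrMr// /M mulKf ?gt_eqF//.
  have := bernoulli_second_moment w0 (fun i => rnorm_ge0 (x i 0 t)).
  move=> /le_trans; apply; apply: lerD => //.
  rewrite lerXn2r ?nnegrE ?invr_ge0 ?(ltW e0)//.
    by apply: sumr_ge0 => i _; rewrite mulr_ge0 ?rnorm_ge0.
  apply: (@le_trans _ _ (\sum_i eta^-1 * (w i * rnorm (x i 0 t) ^+ 2))).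
    apply: ler_sum => i _; rewrite mulrCA ler_wpM2l// mulrC expr2 -mulrA.
    have [->|h] := xe i t; first by rewrite mul0r.
    by rewrite ler_peMr ?rnorm_ge0// ler_pdivlMr// mul1r.
  by rewrite -mulr_sumr ler_piMr// invr_ge0 ltW.
have high : \sum_(f : cube) P f * \sum_i (f i)%:R * rnorm (S (hi f i)) `^ q <= A / n0%:R.
  (* A copy number, a selection and a selected index. *)
  pose J : finType := ('I_n0 * (cube * I))%type.
  have : weighted_sum S (fun j : J => P j.2.1 * (j.2.1 j.2.2)%:R)
      (fun j => hi j.2.1 j.2.2) <= A.
    apply: hA; split=> [[r [f i]]|[r [f i]] t|t] /=.
    - case: (f i); rewrite ?mulr1 ?mulr0 ?lexx ?ler01//.
      by rewrite P0 bernoulli_weight_le1.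
    - by rewrite (le_trans (rnorm_restrict_coords _ _ _)).
    - rewrite -(pair_bigA _ (fun (r : 'I_n0) (fi : cube * I) =>
        P fi.1 * (fi.1 fi.2)%:R * rnorm (hi fi.1 fi.2 0 t) ^+ 2)) /=.
      rewrite sumr_const card_ord -[leLHS]mulr_natl mulrC -ler_pdivlMr// mul1r.
      apply: le_trans (tail t).
      rewrite -(pair_bigA _ (fun (f : cube) i =>
        P f * (f i)%:R * rnorm (hi f i 0 t) ^+ 2)) /=.
      by apply: ler_sum => f _; rewrite mulr_sumr; apply: ler_sum => i _; rewrite mulrA.
  rewrite /weighted_sum -(pair_bigA _ (fun (r : 'I_n0) (fi : cube * I) =>
        P fi.1 * (fi.1 fi.2)%:R * rnorm (S (hi fi.1 fi.2)) `^ q)) /=.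
  rewrite sumr_const card_ord -[leLHS]mulr_natl mulrC -ler_pdivlMr//.
  apply: le_trans.
  rewrite -(pair_bigA _ (fun (f : cube) i =>
        P f * (f i)%:R * rnorm (S (hi f i)) `^ q)) /=.
  by apply: ler_sum => f _; rewrite mulr_sumr; apply: ler_sum => i _; rewrite mulrA.
rewrite /weighted_sum -bernoulli_mean.
apply: (@le_trans _ _ (\sum_(f : cube) P f * (2 `^ q * ((C * M) `^ q +
    \sum_i (f i)%:R * rnorm (S (hi f i)) `^ q)))).
  apply: ler_sum => f _; rewrite ler_wpM2l//.
  apply: (@le_trans _ _ (2 `^ q * (\sum_i (f i)%:R * rnorm (S (lo f i)) `^ q +
      \sum_i (f i)%:R * rnorm (S (hi f i)) `^ q))); last first.
    by rewrite ler_wpM2l ?powR_ge0// lerD2r.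
  rewrite -big_split mulr_sumr; apply: ler_sum => i _ /=.
  rewrite -mulrDr mulrCA ler_wpM2l//.
  apply: le_trans (powRD_le (ltW q0) (rnorm_ge0 _) (rnorm_ge0 _)).
  rewrite ge0_ler_powR ?nnegrE ?addr_ge0 ?rnorm_ge0 ?(ltW q0)//.
  by rewrite {1}(restrict_coords_split (B f) (x i)) linearD ler_rnormD.
under eq_bigr do rewrite mulrCA.
rewrite -mulr_sumr ler_wpM2l ?powR_ge0//.
under eq_bigr do rewrite mulrDr.
by rewrite big_split/= -mulr_suml bernoulli_total mul1r lerD2l.
Qed.

End Operator.

(** Splitting the entries at a level [eta] and choosing first [eta], then the
    number [n0] of copies, makes the best constant self-improving. *)
Lemma cotype_gt2_sup_contraction_summing : exists D : R,
  forall N (S : {linear 'rV[K]_N -> F}), sup_contraction S ->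
  forall m (x : 'I_m -> 'rV[K]_N),
    (forall t, \sum_j rnorm (x j 0 t) ^+ 2 <= 1) ->
    \sum_j rnorm (S (x j)) `^ q <= D.
Proof.
pose c : R := 2 `^ q.
have c1 : 1 <= c by rewrite -(powRr0 2) ler_powR ?ler1n// ltW.
have c0 : 0 < c by lra.
(* [eta] makes the small entries contribute [A / 4], and then [n0] the large
   ones another [A / 4]. *)
pose eta : R := (4 * c)^-1 `^ (q - 2)^-1.
have qq : 0 < q - 2 by rewrite subr_gt0.
have e0 : 0 < eta by rewrite powR_gt0// invr_gt0 mulr_gt0.
have e1 : eta <= 1.
  have h1 : 1 `^ (q - 2)^-1 = 1 :> R by rewrite powR1.
  rewrite -[leRHS]h1 ge0_ler_powR ?nnegrE ?invr_ge0 ?(ltW qq)//.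
    by rewrite mulr_ge0// ltW.
  by rewrite invf_le1 ?mulr_gt0//; lra.
have eE : eta `^ (q - 2) = (4 * c)^-1.
  by rewrite -powRrM mulVf ?gt_eqF// powRr1// invr_ge0 mulr_ge0// ltW.
pose n0 := (Num.truncn (4 * c ^+ 2)).+1.
have n0E : 4 * c ^+ 2 <= n0%:R by rewrite ltW// truncnS_gt.
have n00 : 0 < n0%:R :> R by rewrite ltr0n.
exists (2 * (c ^+ 2 * (C * (n0%:R * (1 + eta^-1 ^+ 2))) `^ q)).
move=> N S S1 m x x1; set D := c ^+ 2 * _.
pose V : set R := [set v | exists (I : finType) (w : I -> R) (y : I -> 'rV[K]_N),
  weighted_family w y /\ v = weighted_sum S w y].
apply: (@self_improving_bound _ V N%:R); last first.
- exists 'I_m, (fun=> 1), x; split; last by apply: eq_bigr => j _; rewrite mul1r.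
  split=> [_|j t|t]; first by rewrite ler01 lexx.
    rewrite -(@expr_le1 _ 2) ?rnorm_ge0// (le_trans _ (x1 t))//.
    by rewrite (bigD1 j)//= lerDl sumr_ge0// => i _; exact: sqr_ge0.
  by under eq_bigr do rewrite mul1r.
- move=> A VA _ [I [w [y [fam ->]]]].
  have hA (I' : finType) (w' : I' -> R) (y' : I' -> 'rV[K]_N) :
      weighted_family w' y' -> weighted_sum S w' y' <= A.
    by move=> fam'; apply: VA; exists I', w', y'.
  have A0 : 0 <= A.
    apply: le_trans (hA 'I_0 (fun=> 0) (fun=> 0) _).
      by rewrite /weighted_sum big_ord0.
    by split=> [[]//|[]//|t]; rewrite big_ord0.
  have [w01 y1 wy] := fam.
  pose B i t := rnorm (y i 0 t) <= eta.
  have sub (D' : I -> pred 'I_N) : weighted_family w (fun i => restrict_coords (D' i) (y i)).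
    split=> // [i t|t]; first by rewrite (le_trans (rnorm_restrict_coords _ _ _)).
    apply: le_trans (wy t); apply: ler_sum => i _; have /andP[w0 _] := w01 i.
    by rewrite ler_wpM2l// lerXn2r ?nnegrE ?rnorm_ge0// rnorm_restrict_coords.
  have small := weighted_sum_small hA e0 e1 (sub B).
  have large := @weighted_sum_large N S S1 A hA eta n0 I w _ e0 isT (sub (fun i => predC (B i))).
  have {}small : weighted_sum S w (fun i => restrict_coords (B i) (y i)) <= (4 * c)^-1 * A.
    rewrite -eE; apply: small => i t; rewrite mxE; case: ifP => // _.
    by rewrite rnorm0 ltW.
  have {}large : weighted_sum S w (fun i => restrict_coords (predC (B i)) (y i)) <=
      c * ((C * (n0%:R * (1 + eta^-1 ^+ 2))) `^ q + A / n0%:R).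
    apply: large => i t; rewrite mxE /= /B; case: ifPn => [|_]; last by left; exact: rnorm0.
    by rewrite -ltNge => /ltW; right.
  apply: (@le_trans _ _ (c * ((4 * c)^-1 * A +
     c * ((C * (n0%:R * (1 + eta^-1 ^+ 2))) `^ q + A / n0%:R)))).
    apply: (@le_trans _ _ (c * (weighted_sum S w (fun i => restrict_coords (B i) (y i)) +
        weighted_sum S w (fun i => restrict_coords (predC (B i)) (y i))))).
      rewrite /weighted_sum -big_split mulr_sumr; apply: ler_sum => i _ /=.
      have /andP[w0 _] := w01 i; rewrite -mulrDr mulrCA ler_wpM2l//.
      apply: le_trans (powRD_le (ltW q0) (rnorm_ge0 _) (rnorm_ge0 _)).
      rewrite ge0_ler_powR ?nnegrE ?addr_ge0 ?rnorm_ge0 ?(ltW q0)//.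
      by rewrite {1}(restrict_coords_split (B i) (y i)) linearD ler_rnormD.
    by rewrite ler_pM2l// lerD.
  have h1 : c * ((4 * c)^-1 * A) = A / 4 by field; rewrite gt_eqF.
  have h2 : c ^+ 2 * (A / n0%:R) <= A / 4.
    rewrite mulrCA ler_wpM2l// ler_pdivrMr//; lra.
  by rewrite mulrDr h1 mulrA -expr2 mulrDr -/D; lra.
- by move=> _ [I [w [y [fam ->]]]]; exact: weighted_sum_le_dim.
Qed.

End CotypeLarge.

(** * Real-linear functionals and weak boundedness *)

Section RealFunctionals.
Context {R : realType} {k : scalars}.
Local Notation K := (scalar_field R k).
Context {X : normedModType K}.
Implicit Types (x y u : X) (f : X -> R).

Definition real_functional (c : R) f :=
  [/\ forall x y, f (x + y) = f x + f y,
      forall r x, f (kemb k r *: x) = r * f x &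
      forall x, f x <= c * rnorm x].

Lemma real_functionalN c f x : real_functional c f -> f (- x) = - f x.
Proof. by move=> [_ fZ _]; have := fZ (-1) x; rewrite rmorphN1 scaleN1r mulN1r. Qed.

Lemma real_functional_norm c f x : real_functional c f -> `|f x| <= c * rnorm x.
Proof.
move=> fR; have [_ _ fx] := fR; rewrite ler_norml fx andbT lerNl.
by rewrite -(real_functionalN _ fR) (le_trans (fx _))// rnormN.
Qed.

Lemma real_functional_sum c f (I : finType) (a : I -> R) (v : I -> X) :
  real_functional c f ->
  f (\sum_i kemb k (a i) *: v i) = \sum_i a i * f (v i).
Proof.
move=> [fD fZ _]; have f0 : f 0 = 0 by have := fZ 0 0; rewrite scaler0 mul0r.
by rewrite (big_morph f fD f0); apply: eq_bigr => i _; rewrite fZ.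
Qed.

(** The graph of a partial real-linear functional dominated by the norm;
    domination already makes it single-valued. *)
Definition dominated_graph (G : set (X * R)) :=
  [/\ forall p r, G p -> G r -> G (p.1 + r.1, p.2 + r.2),
      forall (t : R) p, G p -> G (kemb k t *: p.1, t * p.2) &
      forall p, G p -> p.2 <= rnorm p.1].

(** One-dimensional step of the Hahn-Banach theorem: any value between
    [sup (s - |y - x0|)] and [inf (|y + x0| - s)] over the graph is possible
    at [x0]. *)
Lemma dominated_graph_extend (G : set (X * R)) x0 : G (0, 0) ->
  dominated_graph G -> exists (a : R) (G' : set (X * R)),
    [/\ dominated_graph G', G `<=` G' & G' (x0, a)].
Proof.
move=> G0 [GD GZ Gn].
pose L : set R := [set p.2 - rnorm (p.1 - x0) | p in G].
have Lub p r : G p -> G r -> p.2 - rnorm (p.1 - x0) <= rnorm (r.1 + x0) - r.2.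
  move=> Gp Gr; have /= h := Gn _ (GD _ _ Gp Gr).
  have := ler_rnormD (p.1 - x0) (r.1 + x0).
  by rewrite addrACA addNr addr0; lra.
pose a := sup L.
have aL p : G p -> p.2 - rnorm (p.1 - x0) <= a.
  move=> Gp; apply: ub_le_sup; last by exists p.
  by exists (rnorm (0 + x0) - 0) => _ [r Gr <-]; apply: (Lub r (0, 0)).
have aU r : G r -> a <= rnorm (r.1 + x0) - r.2.
  move=> Gr; apply: ge_sup; first by exists (0 - rnorm (0 - x0)), (0, 0).
  by move=> _ [p Gp <-]; exact: Lub.
exists a, [set p | exists y s t, [/\ G (y, s), p.1 = y + kemb k t *: x0 & p.2 = s + t * a]].
split.
- split.
  + move=> [_ _] [_ _] [y [s [t [Gys /= -> ->]]]] [y' [s' [t' [Gys' /= -> ->]]]].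
    exists (y + y'), (s + s'), (t + t'); split; first exact: (GD _ _ Gys Gys').
      by rewrite rmorphD scalerDl addrACA.
    by ring.
  + move=> r [_ _] [y [s [t [Gys /= -> ->]]]].
    exists (kemb k r *: y), (r * s), (r * t); split; first exact: (GZ r _ Gys).
      by rewrite scalerDr scalerA rmorphM.
    by ring.
  + move=> [_ _] [y [s [t [Gys /= -> ->]]]].
    have [t0|t0|->] := ltrgt0P t; last 1 first.
    * by rewrite mul0r addr0 rmorph0 scale0r addr0; exact: (Gn _ Gys).
    * have /= := aU _ (GZ t^-1 _ Gys) => h.
      have -> : y + kemb k t *: x0 = kemb k t *: (kemb k t^-1 *: y + x0).
        by rewrite scalerDr scalerA -rmorphM mulfV ?gt_eqF// rmorph1 scale1r.
      rewrite rnormZ rnorm_kemb gtr0_norm//.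
      have -> : s + t * a = t * (t^-1 * s + a) by field; rewrite gt_eqF.
      by rewrite ler_pM2l//; lra.
    * have /= := aL _ (GZ (- t)^-1 _ Gys) => h.
      have Nt0 : 0 < - t by rewrite oppr_gt0.
      have -> : y + kemb k t *: x0 = kemb k (- t) *: (kemb k (- t)^-1 *: y - x0).
        rewrite scalerBr scalerA -rmorphM mulfV ?gt_eqF// rmorph1 scale1r.
        by rewrite rmorphN scaleNr opprK.
      rewrite rnormZ rnorm_kemb gtr0_norm//.
      have -> : s + t * a = - t * ((- t)^-1 * s - a) by field; rewrite lt_eqF.
      by rewrite ler_pM2l//; lra.
- move=> [y s] Gys; exists y, s, 0; split=> //=; first by rewrite rmorph0 scale0r addr0.
  by rewrite mul0r addr0.
- by exists 0, 0, 1; split=> //=; rewrite ?rmorph1 ?scale1r ?add0r ?mul1r.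
Qed.

(** The Hahn-Banach theorem: Zorn's lemma applied to the dominated graphs that
    contain the line through [(u, |u|)]; a maximal one is total by the
    one-dimensional step. *)
Lemma norming_functional u : exists f, real_functional 1 f /\ f u = rnorm u.
Proof.
pose G0 : set (X * R) := [set p | exists r, p = (kemb k r *: u, r * rnorm u)].
have dG0 : dominated_graph G0.
  split.
  - move=> _ _ [r ->] [s ->]; exists (r + s) => /=.
    by rewrite rmorphD scalerDl mulrDl.
  - by move=> t _ [r ->]; exists (t * r); rewrite /= rmorphM scalerA mulrA.
  - move=> _ [r ->] /=; rewrite rnormZ rnorm_kemb ler_wpM2r ?rnorm_ge0//.
    exact: ler_norm.
have [F0 FP Ftot|A [dA maxA]] := @Zorn_bigcup _ [set A | dominated_graph (G0 `|` A)].
  set U := \bigcup_(A in F0) A.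
  pose F1 := F0 `|` [set set0].
  have F1P A : F1 A -> dominated_graph (G0 `|` A).
    by case=> [/FP//|->]; rewrite setU0.
  have F1U A : F1 A -> G0 `|` A `<=` G0 `|` U.
    move=> FA; apply: setUS; case: FA => [FA|->]; last exact: sub0set.
    exact: bigcup_sup.
  have one p : (G0 `|` U) p -> exists2 A, F1 A & (G0 `|` A) p.
    case=> [G0p|[A FA Ap]]; first by exists set0; [right|left].
    by exists A; [left|right].
  have two p r : (G0 `|` U) p -> (G0 `|` U) r ->
      exists2 A, F1 A & (G0 `|` A) p /\ (G0 `|` A) r.
    move=> /one[A FA Ap] /one[B FB Br].
    have [AB|BA] : A `<=` B \/ B `<=` A.
      case: FA FB => [FA|->] [FB|->]; try by [left; exact: sub0set|right; exact: sub0set].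
      exact: Ftot.
    - by exists B => //; split=> //; exact: setUS AB _ Ap.
    - by exists A => //; split=> //; exact: setUS BA _ Br.
  split=> [p r /two h /h[A FA [Ap Ar]]|t p /one[A FA Ap]|p /one[A FA Ap]].
  - by apply: (F1U A) => //; have [GD _ _] := F1P A FA; exact: GD.
  - by apply: (F1U A) => //; have [_ GZ _] := F1P A FA; exact: GZ.
  - by have [_ _ Gn] := F1P A FA; exact: Gn.
have {maxA} total x : exists r, (G0 `|` A) (x, r).
  have [|a [G' [dG' AG' xa]]] := dominated_graph_extend x _ dA.
    by left; exists 0; rewrite rmorph0 scale0r mul0r.
  exists a; apply: contrapT => nxa.
  have [AG|] := pselect (A `<` G').
    by apply: (maxA _ AG); rewrite /= setUidr// => p G0p; apply: AG'; left.
  apply; split; first by move=> p Ap; apply: AG'; right.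
  by move=> /(_ _ xa) h; apply: nxa; right.
have [GD GZ Gn] := dA.
have [f hf] := choice total.
have single x r s : (G0 `|` A) (x, r) -> (G0 `|` A) (x, s) -> r <= s.
  move=> Gr Gs; have := Gn _ (GD _ _ Gr (GZ (-1) _ Gs)).
  rewrite /= rmorphN1 scaleN1r subrr rnorm0; lra.
have fE x r : (G0 `|` A) (x, r) -> f x = r.
  by move=> Gr; apply/eqP; rewrite eq_le !(single x).
exists f; split; last by apply: fE; left; exists 1; rewrite rmorph1 scale1r mul1r.
split=> [x y|r x|x]; last by rewrite mul1r; exact: Gn (hf x).
- by apply: fE; exact: GD (hf x) (hf y).
- by apply: fE; exact: GZ r _ (hf x).
Qed.

End RealFunctionals.

Section Geometric.
Context {R : realType}.

Lemma eq0_of_le_geometric (y D : R) :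
  (forall n, `|y| <= D * (3 ^+ n)^-1) -> y = 0.
Proof.
move=> h; apply/eqP; rewrite -normr_le0 leNgt; apply/negP => y0.
pose n := (Num.truncn (D / `|y|)).+1.
have : D / `|y| < n%:R by rewrite truncnS_gt.
rewrite ltr_pdivrMr// mulrC => h1.
have := h n; rewrite ler_pdivlMr ?exprn_gt0// leNgt => /negP; apply.
apply: (lt_le_trans h1); rewrite ler_wpM2l ?(ltW y0)// -natrX ler_nat.
by rewrite ltnW// ltn_expl.
Qed.

(** A sequence with geometrically decreasing increments is squeezed between
    two monotone sequences. *)
Lemma geometric_limit (a : nat -> R) (C : R) :
  (forall n, `|a n.+1 - a n| <= C * (3 ^+ n)^-1) ->
  exists l, forall n, `|l - a n| <= 3 / 2 * C * (3 ^+ n)^-1.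
Proof.
move=> h; pose t n : R := 3 / 2 * C * (3 ^+ n)^-1.
have tS n : t n - t n.+1 = C * (3 ^+ n)^-1.
  by rewrite /t exprS; field; rewrite expf_neq0.
have lo n : a n - t n <= a n.+1 - t n.+1.
  by have := h n; rewrite -tS ler_norml => /andP[]; lra.
have hi n : a n.+1 + t n.+1 <= a n + t n.
  by have := h n; rewrite -tS ler_norml => /andP[]; lra.
have C0 : 0 <= C by have := h 0%N; rewrite expr0 invr1 mulr1; apply: le_trans.
have t0 n : 0 <= t n by rewrite !mulr_ge0// invr_ge0 exprn_ge0.
have lom n m : (n <= m)%N -> a n - t n <= a m - t m.
  by move=> nm; have := @homo_leq _ (fun n => a n - t n) <=%R lexx le_trans lo n m nm.
have him n m : (n <= m)%N -> a m + t m <= a n + t n.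
  move=> nm; rewrite -lerN2.
  apply: (@homo_leq _ (fun n => - (a n + t n)) <=%R lexx le_trans _ n m nm) => i.
  by rewrite lerN2.
have cross n m : a n - t n <= a m + t m.
  have [nm|mn] := leqP n m.
    by have := lom _ _ nm; have := t0 m; lra.
  by have := him _ _ (ltnW mn); have := t0 n; lra.
pose L : set R := range (fun n => a n - t n).
have Lub m : ubound L (a m + t m) by move=> _ [n _ <-].
exists (sup L) => n; rewrite ler_distl; apply/andP; split.
  by apply: ub_le_sup; [exists (a 0%N + t 0%N); exact: Lub|exists n].
by apply: ge_sup; [exists (a 0%N - t 0%N), 0%N|exact: Lub].
Qed.

End Geometric.

Section UniformBoundedness.
Context {R : realType} {k : scalars}.
Local Notation K := (scalar_field R k).
Context {X : normedModType K}.

(** A gliding hump: if [U] contains vectors [u n] of rapidly growing norms, then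
    signs can be chosen in [\sum_n +- 3 ^- n f n], where [f n] norms [u n], so
    that the partial sums up to [n] are at least [3 ^- n |u n|] at [u n]; the
    later terms undo at most half of this. *)
Lemma weakly_bounded_norm_bounded (U : set X) :
  (forall c (f : X -> R), real_functional c f ->
    exists M, forall u, U u -> `|f u| <= M) ->
  exists W, forall u, U u -> rnorm u <= W.
Proof.
move=> wb; apply: contrapT => unbounded.
have pick_u n : exists u, U u /\ 2 * n%:R * 3 ^+ n < rnorm u.
  apply: contrapT => h; apply: unbounded; exists (2 * n%:R * 3 ^+ n) => u Uu.
  by rewrite leNgt; apply/negP => un; apply: h; exists u.
have [u hu] := choice pick_u.
have [f hf] := choice (fun n => norming_functional (u n)).
pose psi := fix psi n : X -> R := match n with
  | 0 => fun=> 0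
  | n.+1 => fun x => psi n x +
      (if 0 <= psi n (u n) then 1 else -1) * (3 ^+ n)^-1 * f n x
  end.
have psiS n x : psi n.+1 x = psi n x +
  (if 0 <= psi n (u n) then 1 else -1) * (3 ^+ n)^-1 * f n x by [].
have step x n : `|psi n.+1 x - psi n x| <= rnorm x * (3 ^+ n)^-1.
  rewrite psiS addrAC subrr add0r !normrM.
  rewrite (_ : `|if _ then _ else _| = 1) ?mul1r; last by case: ifP; rewrite ?normrN normr1.
  rewrite gtr0_norm ?invr_gt0 ?exprn_gt0// mulrC ler_wpM2r ?invr_ge0 ?exprn_ge0//.
  by have := real_functional_norm x (hf n).1; rewrite mul1r.
have [l hl] := choice (fun x => geometric_limit (step x)).
have psiD n x y : psi n (x + y) = psi n x + psi n y.
  elim: n => [|n IH]; first by rewrite /= addr0.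
  by rewrite !psiS IH; have [[-> _ _] _] := hf n; ring.
have psiZ n r x : psi n (kemb k r *: x) = r * psi n x.
  elim: n => [|n IH]; first by rewrite /= mulr0.
  by rewrite !psiS IH; have [[_ -> _] _] := hf n; ring.
have lR : real_functional (3 / 2) l.
  split=> [x y|r x|x].
  - apply/eqP; rewrite -subr_eq0; apply/eqP.
    apply: (@eq0_of_le_geometric _ _ (3 / 2 * (rnorm (x + y) + rnorm x + rnorm y))) => n.
    have -> : l (x + y) - (l x + l y) =
        (l (x + y) - psi n (x + y)) - ((l x - psi n x) + (l y - psi n y)).
      by rewrite psiD; ring.
    rewrite (le_trans (ler_normB _ _))// mulrDr mulrDl.
    have := hl (x + y) n; have := hl x n; have := hl y n.
    have := ler_normD (l x - psi n x) (l y - psi n y).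
    by rewrite mulrDr !mulrDl; lra.
  - apply/eqP; rewrite -subr_eq0; apply/eqP.
    apply: (@eq0_of_le_geometric _ _ (3 / 2 * rnorm (kemb k r *: x) +
      `|r| * (3 / 2 * rnorm x))) => n.
    have -> : l (kemb k r *: x) - r * l x =
        (l (kemb k r *: x) - psi n (kemb k r *: x)) - r * (l x - psi n x).
      by rewrite psiZ; ring.
    rewrite (le_trans (ler_normB _ _))// mulrDl.
    apply: lerD; first exact: hl.
    by rewrite normrM -[leRHS]mulrA ler_wpM2l.
  - by have := hl x 0%N; rewrite /= expr0 invr1 mulr1 subr0; apply: le_trans; exact: ler_norm.
have [M hM] := wb _ _ lR.
pose n := (Num.truncn M).+1.
have [Uu un] := hu n.
have Mn : M < n%:R by rewrite truncnS_gt.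
have p0 : 0 < 3 ^+ n :> R by rewrite exprn_gt0.
have := hM _ Uu; rewrite leNgt => /negP; apply.
have h1 : (3 ^+ n)^-1 * rnorm (u n) <= `|psi n.+1 (u n)|.
  rewrite psiS (hf n).2; have v0 : 0 <= (3 ^+ n)^-1 * rnorm (u n).
    by rewrite mulr_ge0 ?rnorm_ge0// invr_ge0 ltW.
  have [pos|neg] := leP 0 (psi n (u n)).
    by rewrite mul1r ger0_norm; [exact: ler_wpDl|exact: addr_ge0].
  rewrite mulN1r mulNr ler0_norm; last by rewrite subr_le0 (le_trans (ltW neg)).
  by rewrite opprD opprK ler_wpDl// oppr_ge0 ltW.
have h2 := hl (u n) n.+1.
have h3 : 3 / 2 * rnorm (u n) * (3 ^+ n.+1)^-1 = (3 ^+ n)^-1 * rnorm (u n) / 2.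
  by rewrite exprS; field; rewrite gt_eqF.
rewrite h3 in h2.
have h4 : n%:R < (3 ^+ n)^-1 * rnorm (u n) / 2.
  rewrite ltr_pdivlMr// ltr_pdivlMl// mulrC; apply: le_lt_trans un.
  by rewrite [_ * 2]mulrC.
have h5 := ler_normB (l (u n)) (l (u n) - psi n.+1 (u n)).
rewrite subKr in h5; lra.
Qed.

(** Complexification of a real-linear functional. *)
Lemma real_functional_dominated c (f : X -> R) : real_functional c f ->
  exists phi : {linear X -> K^o}, continuous phi /\ forall x, `|f x| <= rnorm (phi x).
Proof.
move=> fR; have [fD fZ fn] := fR.
pose g x : K^o := kemb k (f x) - kI R k * kemb k (f (kI R k *: x)).
have gD x y : g (x + y) = g x + g y.
  by rewrite /g fD scalerDr fD !rmorphD mulrDr opprD addrACA.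
have gZ r x : g (kemb k r *: x) = kemb k r * g x.
  have E : kI R k *: (kemb k r *: x) = kemb k r *: (kI R k *: x).
    by rewrite !scalerA mulrC.
  by rewrite /g E !fZ !rmorphM mulrBr [kI R k * (_ * _)]mulrCA.
have gI x : g (kI R k *: x) = kI R k * g x.
  have [->|II] := kI_cases R k.
    by rewrite scale0r mul0r; have := gZ 0 0; rewrite scaler0 rmorph0 mul0r.
  rewrite /g scalerA II scaleN1r (real_functionalN _ fR) rmorphN mulrN opprK.
  by rewrite mulrBr mulrA II mulN1r opprK addrC.
have gL : linear g.
  move=> a x y; rewrite gD; congr (_ + _).
  rewrite [in LHS](kreimE a) scalerDl gD gZ -scalerA gI gZ mulrA -mulrDl.
  by rewrite -kreimE.
pose phi : {linear X -> K^o} := HB.pack g (GRing.isLinear.Build _ _ _ _ g gL).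
exists phi; split; last first.
  move=> x; apply: le_trans (ler_kre _).
  rewrite (_ : scalar_re _ = f x)// /phi /= /g raddfB /= kreK.
  by rewrite kre_kI subr0.
apply: bounded_linear_continuous; apply/linear_boundedP.
exists (kemb k (2 * c)); split.
  by rewrite realE -(rmorph0 (kemb k)) !ler_kemb; exact: le_total.
move=> r cr x; apply: (@le_trans _ _ (kemb k (2 * c) * `|x|)); last first.
  by rewrite ler_wpM2r// ltW.
rewrite !rnormE -rmorphM ler_kemb (le_trans (ler_rnormD _ _))//.
rewrite rnormN rnormM !rnorm_kemb.
have h1 := real_functional_norm x fR.
have h2 := real_functional_norm (kI R k *: x) fR.
rewrite rnormZ in h2.
have c0 : 0 <= c * rnorm x by apply: le_trans h1.
have i1 := rnorm_kI_le1 R k; have i0 := rnorm_ge0 (kI R k).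
have h3 : rnorm (kI R k) * `|f (kI R k *: x)| <= 1 * (c * rnorm x).
  apply: ler_pM => //; apply: (le_trans h2).
  by rewrite mulrCA ler_piMl.
lra.
Qed.

Lemma weakly_summable_bounded (x : nat -> X) : weakly_summable 2 x ->
  exists W, forall m (a : 'I_m -> R), \sum_j a j ^+ 2 <= 1 ->
    rnorm (\sum_j kemb k (a j) *: x j) <= W.
Proof.
move=> wx; pose U : set X := [set u | exists m (a : 'I_m -> R),
  \sum_j a j ^+ 2 <= 1 /\ u = \sum_j kemb k (a j) *: x j].
have [|W hW] := @weakly_bounded_norm_bounded U.
  move=> c f fR; have [phi [phic hphi]] := real_functional_dominated fR.
  have := wx phi phic; set s := (\sum_(0 <= j <oo) _)%E => soo.
  have s0 : (0 <= s)%E by apply: nneseries_ge0 => j _ _; rewrite lee_fin powR_ge0.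
  have sfin : s \is a fin_num by rewrite ge0_fin_numE.
  exists ((1 + fine s) / 2) => _ [m [a [a1 ->]]].
  rewrite (real_functional_sum _ _ fR).
  have hs : \sum_(j < m) f (x j) ^+ 2 <= fine s.
    rewrite -lee_fin fineK//.
    have := @nneseries_lim_ge R (fun j => (rnorm (phi (x j)) `^ 2)%:E) xpredT 0%N m.
    move=> /(_ (fun j _ _ => _)) h; apply: le_trans (h _); last first.
      by move=> j; rewrite lee_fin powR_ge0.
    rewrite sumEFin lee_fin big_mkord; apply: ler_sum => j _.
    by rewrite powR_mulrn ?rnorm_ge0// -real_normK ?num_real// lerXn2r ?nnegrE ?rnorm_ge0.
  rewrite (le_trans (ler_norm_sum _ _ _))//.
  apply: (@le_trans _ _ (\sum_(j < m) (a j ^+ 2 + f (x j) ^+ 2) / 2)).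
    apply: ler_sum => j _; rewrite normrM -(real_normK (num_real (a j))).
    rewrite -(real_normK (num_real (f _))).
    by have := sqr_ge0 (`|a j| - `|f (x j)|); nra.
  by rewrite -mulr_suml big_split/= ler_pM2r// lerD.
exists W => m a a1; apply: hW; by exists m, a.
Qed.

End UniformBoundedness.

(** * Weakly square-summable sequences in [L_oo] spaces *)

Section LinftyFactorization.
Context {R : realType} {k : scalars}.
Local Notation K := (scalar_field R k).

Lemma rnorm_coord_le N (y : 'rV[K]_N) t : rnorm (y 0 t) <= rnorm y.
Proof.
rewrite -(ler_kemb k) -!rnormE [leRHS]mx_normE -[leLHS]nngE num_le.
exact: (le_bigmax _ (fun i : 'I_1 * 'I_N => `|y i.1 i.2|%:nng%R) (0, t)).
Qed.

Lemma rnorm_row_le N (y : 'rV[K]_N) (c : R) : 0 <= c ->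
  (forall t, rnorm (y 0 t) <= c) -> rnorm y <= c.
Proof.
move=> c0 yc; have [y0|y0] := eqVneq (mx_norm y) 0.
  by rewrite (mx_norm_eq0 y0) rnorm0.
have [[i j] /= h] := mx_norm_neq0 y0.
by rewrite (ord1 i) in h; have := yc j; rewrite /rnorm -h.
Qed.

Lemma opnorm_on_le (V W : normedModType K) (D : set V) (f : V -> W) (r : R) :
  (forall (t : R) x, D x -> D (kemb k t *: x) /\ f (kemb k t *: x) = kemb k t *: f x) ->
  (opnorm_on D f <= r%:E)%E -> forall x, D x -> rnorm (f x) <= r * rnorm x.
Proof.
move=> fZ fr x Dx; have [x0|x0] := eqVneq (rnorm x) 0.
  have := (fZ 0 x Dx).2; rewrite rmorph0 !scale0r (rnorm_eq0 x0) => ->.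
  by rewrite !rnorm0 mulr0.
have xp : 0 < rnorm x by rewrite lt_neqAle eq_sym x0 rnorm_ge0.
have [Dy fy] := fZ (rnorm x)^-1 x Dx.
have := ereal_sup_ubound (S := [set (rnorm (f z))%:E | z in [set z | D z /\ rnorm z <= 1]]).
move=> /(_ (rnorm (f (kemb k (rnorm x)^-1 *: x)))%:E) h.
rewrite -ler_pdivrMr// mulrC -lee_fin; apply: le_trans fr; apply: le_trans (h _); last first.
  exists (kemb k (rnorm x)^-1 *: x) => //; split=> //.
  by rewrite rnormZ rnorm_kemb gtr0_norm ?invr_gt0// mulVf.
by rewrite fy rnormZ rnorm_kemb gtr0_norm ?invr_gt0.
Qed.

Lemma opnorm_on_ge0 (V W : normedModType K) (D : set V) (f : V -> W) :
  D 0 -> (0 <= opnorm_on D f)%E.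
Proof.
move=> D0; apply: (@le_trans _ _ (rnorm (f 0))%:E); first by rewrite lee_fin rnorm_ge0.
by apply: ereal_sup_ubound; exists 0 => //; split=> //; rewrite rnorm0.
Qed.

(** By induction on the family: a vector outside the span of the others extends
    their basis. *)
Lemma finite_family_sub_subspace (X : normedModType K) m (v : 'I_m -> X) :
  exists d (G : set X), subspace_of_dim d G /\ forall j, G (v j).
Proof.
elim: m v => [|m IH] v.
  exists 0%N, [set x | exists c : 'I_0 -> K, x = \sum_i c i *: (fun=> 0 : X) i].
  by split=> [|[]//]; exists (fun=> 0); split=> // c _ [].
have [d [G [Gd Gv]]] := IH (fun j => v (lift ord0 j)).
have [Gv0|nGv0] := pselect (G (v ord0)).
  exists d, G; split=> // j; have [i ->|->//] := unliftP ord0 j; exact: Gv.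
have [b [bfree bG]] := Gd.
pose b' (i : 'I_d.+1) := oapp b (v ord0) (unlift ord0 i).
have b'0 : b' ord0 = v ord0 by rewrite /b' unlift_none.
have b'S i : b' (lift ord0 i) = b i by rewrite /b' liftK.
have sumb' (c : 'I_d.+1 -> K) : \sum_i c i *: b' i =
    c ord0 *: v ord0 + \sum_i c (lift ord0 i) *: b i.
  by rewrite big_ord_recl b'0; congr (_ + _); apply: eq_bigr => i _; rewrite b'S.
exists d.+1, [set x | exists c : 'I_d.+1 -> K, x = \sum_i c i *: b' i]; split.
  exists b'; split=> // c; rewrite sumb' => c0.
  have c00 : c ord0 = 0.
    apply/eqP; apply/negPn/negP => n0; apply: nGv0; rewrite bG.
    exists (fun i => - ((c ord0)^-1 * c (lift ord0 i))).
    have : v ord0 = - ((c ord0)^-1 *: \sum_i c (lift ord0 i) *: b i).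
      by rewrite -scalerN -(addr0_eq c0) opprK scalerA mulVf// scale1r.
    by move=> ->; rewrite scaler_sumr -sumrN; apply: eq_bigr => i _; rewrite scaleNr scalerA.
  rewrite c00 scale0r add0r in c0 => i.
  by have [j ->|->//] := unliftP ord0 i; exact: bfree c0 j.
move=> j; have [i ->|->] := unliftP ord0 j.
  have := Gv i; rewrite bG => -[c ->].
  exists (fun i => oapp c 0 (unlift ord0 i)); rewrite sumb' unlift_none scale0r add0r.
  by apply: eq_bigr => l _; rewrite liftK.
exists (fun i => oapp (fun=> 0) 1 (unlift ord0 i)); rewrite sumb' unlift_none scale1r.
by rewrite big1 ?addr0// => l _; rewrite liftK scale0r.
Qed.

(** The finite-dimensional model: on finitely many terms of a weakly
    square-summable sequence of an [L_oo] space, the coordinates of the isomorphism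
    onto [l_oo^N] are bounded functionals, so that these terms are the images of a
    weakly square-summable family under an operator, with bounds that do not
    depend on their number. *)
Lemma Linfty_factorization (X : normedModType K) (x : nat -> X) :
  Linfty_space X -> weakly_summable 2 x ->
  exists2 rho : R, 0 < rho & forall m,
    exists N (w : {linear 'rV[K]_N -> X}) (z : 'I_m -> 'rV[K]_N),
    [/\ forall y : 'rV[K]_N, (forall t, rnorm (y 0 t) <= 1) -> rnorm (w y) <= rho,
        forall j : 'I_m, x j = w (z j) &
        forall t, \sum_j rnorm (z j 0 t) ^+ 2 <= 1].
Proof.
move=> [lambda lambda1 XL] wx; have [W0 hW0] := weakly_summable_bounded wx.
pose W := `|W0| + 1; have W_gt0 : 0 < W by rewrite ltr_wpDl.
have hW m (a : 'I_m -> R) : \sum_j a j ^+ 2 <= 1 ->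
    rnorm (\sum_j kemb k (a j) *: x j) <= W.
  by move=> /hW0 h; rewrite (le_trans h)// (le_trans (ler_norm _))// lerDl.
exists (2 * lambda * W); first by rewrite !mulr_gt0//; lra.
move=> m; have [d [G [Gd Gx]]] := finite_family_sub_subspace (fun j : 'I_m => x j).
have [H [N [[b [_ HE]] GH [v [w [[vL wH wv vw] vw_lt]]]]]] := XL _ _ Gd.
have Hx (j : 'I_m) : H (x j) by apply/GH/Gx.
have HL (a : K) y z : H y -> H z -> H (a *: y + z).
  rewrite HE => -[c ->] [c' ->]; exists (fun i => a * c i + c' i).
  by rewrite scaler_sumr -big_split; apply: eq_bigr => i _; rewrite scalerDl scalerA.
have H0 : H 0.
  by rewrite HE; exists (fun=> 0); rewrite big1// => i _; rewrite scale0r.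
have HZ (a : K) y : H y -> H (a *: y) by move=> Hy; rewrite -[_ *: _]addr0; exact: HL.
have v0 : v 0 = 0.
  by have := vL (-1) 0 0 H0 H0; rewrite scaler0 addr0 scaleN1r addNr.
have vZ (a : K) y : H y -> v (a *: y) = a *: v y.
  by move=> Hy; have := vL a y 0 Hy H0; rewrite v0 !addr0.
have wL : linear w.
  by move=> a y z; rewrite -[RHS]wv ?vL ?vw//; exact: HL.
pose w' : {linear 'rV[K]_N -> X} := HB.pack w (GRing.isLinear.Build _ _ _ _ w wL).
have wE y : w y = w' y by [].
have wZ a y : w (a *: y) = a *: w y by rewrite wE linearZ.
(* The product of the operator norms alone does not bound both factors: one may
   be infinite if the other vanishes, and then [H] is trivial. *)
have [Htriv|[B [C [B0 C0 BC wB vC]]]] : (forall y, H y -> y = 0) \/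
    exists B C : R, [/\ 0 < B, 0 <= C, B * C < lambda,
      forall y, rnorm (w y) <= B * rnorm y & forall y, H y -> rnorm (v y) <= C * rnorm y].
- have vle (r : R) := @opnorm_on_le X _ H v r (fun t y Hy => conj (HZ _ _ Hy) (vZ _ _ Hy)).
  have wle (r : R) : (opnorm_on setT w <= r%:E)%E -> forall y, rnorm (w y) <= r * rnorm y.
    by move=> h y; apply: (opnorm_on_le _ h) => // t z _; split=> //; rewrite wE linearZ.
  have v_ge0 := opnorm_on_ge0 v H0.
  have w_ge0 := @opnorm_on_ge0 _ _ setT w I.
  have triv_w : (opnorm_on setT w <= 0)%E -> forall y, H y -> y = 0.
    move=> /wle h y Hy; rewrite -(wv _ Hy); apply: rnorm_eq0.
    by apply/eqP; rewrite eq_le rnorm_ge0 andbT; have := h (v y); rewrite mul0r.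
  have triv_v : (opnorm_on H v <= 0)%E -> forall y, H y -> y = 0.
    move=> /vle h y Hy; rewrite -(wv _ Hy) wE.
    have := h y Hy; rewrite mul0r => h0.
    rewrite (rnorm_eq0 (x := v y)) ?linear0//.
    by apply/eqP; rewrite eq_le rnorm_ge0 andbT.
  have [/triv_w|w_gt0] := leP (opnorm_on setT w) 0%E; first by left.
  have [/triv_v|v_gt0] := leP (opnorm_on H v) 0%E; first by left.
  right.
  case Ew : (opnorm_on setT w) w_gt0 vw_lt => [B| |]// B0; last first.
    by rewrite gt0_muley// ltNge leey.
  case Ev : (opnorm_on H v) v_gt0 => [C| |]// C0; last by rewrite gt0_mulye// ltNge leey.
  rewrite -EFinM lte_fin mulrC => BC; exists B, C; split=> //.
  - by rewrite ltW.
  - by apply: wle; rewrite Ew.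
  - by apply: vle; rewrite Ev.
- exists 0%N, (\0 : {linear 'rV[K]_0 -> X}), (fun=> 0); split=> [y _|j|[]//].
    by rewrite /= rnorm0 !mulr_ge0 ?ltW//; lra.
  exact: Htriv.
(* The factor 2 absorbs the sum of the real and imaginary parts. *)
pose tau := 2 * (lambda / B) * W.
have tau0 : 0 < tau by rewrite !mulr_gt0 ?invr_gt0//; lra.
have CB : C <= lambda / B by rewrite ler_pdivlMr// mulrC ltW.
have part (g : K -> R) t : (forall a b, g (a + b) = g a + g b) ->
    (forall r a, g (kemb k r * a) = r * g a) -> (forall a, `|g a| <= rnorm a) ->
    \sum_(j < m) g (v (x j) 0 t) ^+ 2 <= (C * W) ^+ 2.
  move=> gD gZ gn; set s := \sum_j _.
  have s0 : 0 <= s by apply: sumr_ge0 => j _; exact: sqr_ge0.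
  have [->|sn0] := eqVneq s 0; first exact: sqr_ge0.
  have sp : 0 < Num.sqrt s by rewrite sqrtr_gt0 lt_neqAle eq_sym sn0.
  pose a j := g (v (x j) 0 t) / Num.sqrt s.
  have a1 : \sum_(j < m) a j ^+ 2 <= 1.
    under eq_bigr do rewrite /a exprMn exprVn sqr_sqrtr//.
    by rewrite -mulr_suml mulfV.
  have Hsum n (c : 'I_n -> K) (y : 'I_n -> X) : (forall i, H (y i)) ->
      H (\sum_i c i *: y i) /\ v (\sum_i c i *: y i) = \sum_i c i *: v (y i).
    move=> Hy; elim: n c y Hy => [|n IH] c y Hy; first by rewrite !big_ord0.
    rewrite !big_ord_recl; have [h1 h2] := IH (fun i => c (lift ord0 i)) _ (fun i => Hy (lift ord0 i)).
    by split; [exact: HL|rewrite vL// h2].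
  have [Hu vu] := Hsum m (fun j => kemb k (a j)) _ Hx.
  have g0 : g 0 = 0 by have := gZ 0 0; rewrite mulr0 mul0r.
  have E : g (v (\sum_(j < m) kemb k (a j) *: x j) 0 t) = Num.sqrt s.
    rewrite vu summxE (big_morph g gD g0).
    under eq_bigr do rewrite mxE gZ /a mulrAC -expr2.
    rewrite -mulr_suml -/s -{1}(sqr_sqrtr s0) expr2 mulfK// gt_eqF//.
  rewrite -(sqr_sqrtr s0) lerXn2r ?nnegrE ?(ltW sp) ?mulr_ge0 ?(ltW W_gt0)//.
  rewrite -E (le_trans (ler_norm _))// (le_trans (gn _))//.
  rewrite (le_trans (rnorm_coord_le _ _))// (le_trans (vC _ Hu))//.
  by rewrite ler_wpM2l// hW.
exists N, (kemb k tau \*: w'), (fun j => kemb k tau^-1 *: v (x j)); split.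
- move=> y y1 /=; rewrite rnormZ rnorm_kemb gtr0_norm//.
  have -> : 2 * lambda * W = tau * B by rewrite /tau; field; rewrite gt_eqF.
  rewrite ler_pM2l// (le_trans (wB _))// ler_piMr ?(ltW B0)//.
  exact: rnorm_row_le.
- by move=> j; rewrite /= wZ scalerA -rmorphM mulfV ?gt_eqF// rmorph1 scale1r wv.
- move=> t; under eq_bigr do rewrite mxE rnormM rnorm_kemb exprMn gtr0_norm ?invr_gt0//.
  rewrite -mulr_sumr exprVn mulrC ler_pdivrMr ?exprn_gt0// mul1r.
  under eq_bigr do rewrite rnormK.
  rewrite big_split/=.
  have h1 := part (@scalar_re R k) t (raddfD _) (@kreM R k) (@ler_kre R k).
  have h2 := part (@kim R k) t (raddfD _) (@kimM R k) (@ler_kim R k).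
  apply: (le_trans (lerD h1 h2)).
  have : (C * W) ^+ 2 <= (lambda / B * W) ^+ 2.
    have lB0 := le_trans C0 CB; have W_ge0 := ltW W_gt0.
    have CW : C * W <= lambda / B * W by apply: ler_wpM2r.
    by rewrite lerXn2r// nnegrE mulr_ge0.
  have -> : tau ^+ 2 = 4 * (lambda / B * W) ^+ 2 by rewrite /tau; ring.
  by have := sqr_ge0 (lambda / B * W); lra.
Qed.

End LinftyFactorization.

(** * Bounded multilinear maps *)

Section BoundedMultilinear.
Context {R : realType} {k : scalars} {n : nat}.
Local Notation K := (scalar_field R k).
Context {X : 'I_n -> normedModType K} {F : normedModType K}.

Lemma prod_topology_nbhs_box (U : set (prod_topology X)) (z : prod_topology X) :
  nbhs z U -> exists2 d : R, 0 < d &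
    forall y : prod_topology X, (forall s, rnorm (y s - z s) < d) -> U y.
Proof.
pose box (d : R) : set (prod_topology X) := [set y | forall s, rnorm (y s - z s) < d].
pose B : set_system (prod_topology X) := [set V | exists2 d : R, 0 < d & box d `<=` V].
have FB : Filter B.
  split=> [|P Q [d d0 dP] [e e0 eQ]|P Q PQ [d d0 dP]].
  - by exists 1.
  - exists (Num.min d e); first by rewrite lt_min d0.
    move=> y hy; split; [apply: dP|apply: eQ] => s; apply: lt_le_trans (hy s) _.
      by rewrite ge_min lexx.
    by rewrite ge_min lexx orbT.
  - by exists d => //; exact: subset_trans PQ.
suff : B --> z by move=> Bz /Bz.
apply/cvg_sup => i V [W [Wo Wz] WV].
have [Q oQ QW] := Wo; rewrite -{}QW in Wz WV.
have /nbhs_normP [e /= e0 eQ] : nbhs (z i) Q by apply: open_nbhs_nbhs; split.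
exists (rnorm (e : K)) => [|y hy].
  by rewrite -(ltr_kemb k) -rnormE rmorph0 gtr0_norm.
apply: WV; apply: eQ => /=; rewrite distrC rnormE.
by rewrite -(gtr0_norm e0) rnormE ltr_kemb; exact: hy.
Qed.

Context (T : prod_topology X -> F) (Tlin : multilinear T).

Definition multilinear_slice (x : forall s, X s) (s : 'I_n) : {linear X s -> F} :=
  HB.pack (fun y : X s => T (dfwith x s y))
    (GRing.isLinear.Build _ _ _ _ (fun y : X s => T (dfwith x s y)) (@Tlin s x)).

Lemma multilinearZ (c : K) (x : forall s, X s) (A : seq 'I_n) : uniq A ->
  T (fun s => if s \in A then c *: x s else x s) = c ^+ size A *: T x.
Proof.
elim: A => [_|r A IH /= /andP[rA uA]]; first by rewrite expr0 scale1r.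
pose y : forall s, X s := fun s => if s \in A then c *: x s else x s.
have -> : (fun s => if s \in r :: A then c *: x s else x s) = dfwith y r (c *: y r).
  apply/functional_extensionality_dep => s; rewrite inE.
  have [->|sr] := eqVneq s r; first by rewrite dfwithin /y (negbTE rA).
  by rewrite dfwithout// eq_sym.
have -> : T (dfwith y r (c *: y r)) = multilinear_slice y r (c *: y r) by [].
rewrite linearZ /= exprS -scalerA -IH//; congr (_ *: T _).
apply/functional_extensionality_dep => s.
by have [->|sr] := eqVneq r s; rewrite ?dfwithin// dfwithout.
Qed.

(** By homogeneity, from the box around the origin that continuity provides. *)
Lemma continuous_multilinear_bounded : (0 < n)%N -> continuous T ->
  forall rho : R, exists2 B : R, 0 < B &
    forall x : forall s, X s, (forall s, rnorm (x s) <= rho) -> rnorm (T x) <= B.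
Proof.
move=> n0 Tc rho.
have T0 : T (fun s => 0) = 0.
  have -> : (fun s => 0) = dfwith (fun s => 0 : X s) (Ordinal n0) 0.
    apply/functional_extensionality_dep => s.
    by have [<-|sr] := eqVneq (Ordinal n0) s; rewrite ?dfwithin// dfwithout.
  exact: (linear0 (multilinear_slice (fun s => 0) (Ordinal n0))).
have : nbhs (T (fun s => 0)) [set z | rnorm z < 1].
  rewrite T0; apply/nbhs_norm0P; exists 1 => //= z /=.
  by rewrite rnormE -(rmorph1 (kemb k)) ltr_kemb.
move=> /(Tc (fun s => 0)) /prod_topology_nbhs_box [d d0 hd].
pose c := d / (`|rho| + 1).
have r0 : 0 < `|rho| + 1 by rewrite ltr_wpDl.
have c0 : 0 < c by rewrite divr_gt0.
exists (c^-1 ^+ n) => [|x hx]; first by rewrite exprn_gt0// invr_gt0.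
have : rnorm (T (fun s => kemb k c *: x s)) < 1.
  apply: (hd (fun s => kemb k c *: x s)) => s; rewrite subr0 rnormZ rnorm_kemb gtr0_norm//.
  rewrite /c mulrAC ltr_pdivrMr// ltr_pM2l// (le_lt_trans (hx s))//.
  by rewrite (le_lt_trans (ler_norm _))// ltrDl.
have := @multilinearZ (kemb k c) x (enum 'I_n) (enum_uniq _).
rewrite size_enum_ord => E.
have -> : (fun s => kemb k c *: x s) =
    (fun s => if s \in enum 'I_n then kemb k c *: x s else x s).
  by apply/functional_extensionality_dep => s; rewrite mem_enum.
rewrite E rnormZ -rmorphXn rnorm_kemb gtr0_norm ?exprn_gt0// => /ltW.
by rewrite exprVn -ler_pdivlMl ?exprn_gt0// mulr1.
Qed.

End BoundedMultilinear.

(** * Summability at every point *)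

Section LinearSummability.
Context {R : realType} {k : scalars}.
Local Notation K := (scalar_field R k).

Lemma cotype_sup_contraction_summing (F : normedModType K) (q : R) :
  2 <= q -> has_cotype F q%:E -> exists D : R,
  forall N (S : {linear 'rV[K]_N -> F}), sup_contraction S ->
  forall m (x : 'I_m -> 'rV[K]_N),
    (forall t, \sum_j rnorm (x j 0 t) ^+ 2 <= 1) ->
    \sum_j rnorm (S (x j)) `^ q <= D.
Proof.
rewrite le_eqVlt => /predU1P[<-|q2] [C C0 hC].
  have [D hD] := cotype2_sup_contraction_summing hC.
  exists D => N S S1 m x x1.
  by under eq_bigr do rewrite powR_mulrn ?rnorm_ge0//; exact: hD.
by have [D hD] := cotype_gt2_sup_contraction_summing C0 q2 hC; exists D.
Qed.

Context {X : normedModType K} (x : nat -> X).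
Context (XL : Linfty_space X) (wx : weakly_summable 2 x).

Lemma Linfty_weakly_summable_bounded :
  exists rho : R, forall j, rnorm (x j) <= rho.
Proof.
have [rho _ h] := Linfty_factorization XL wx; exists rho => j.
have [N [w [z [wb xE z1]]]] := h j.+1.
rewrite (xE ord_max); apply: wb => t.
rewrite -(@expr_le1 _ 2) ?rnorm_ge0// (le_trans _ (z1 t))//.
by rewrite (bigD1 ord_max)//= lerDl sumr_ge0// => i _; exact: sqr_ge0.
Qed.

Lemma Linfty_linear_summing (F : normedModType K) (q : R) :
  2 <= q -> has_cotype F q%:E ->
  exists2 rho : R, 0 < rho & exists D : R,
  forall (S : {linear X -> F}) (B : R), 0 < B ->
    (forall y, rnorm y <= rho -> rnorm (S y) <= B) ->
    forall m, \sum_(j < m) rnorm (S (x j)) `^ q <= B `^ q * D.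
Proof.
move=> q2 Fq; have [D hD] := cotype_sup_contraction_summing q2 Fq.
have [rho rho0 h] := Linfty_factorization XL wx.
exists rho => //; exists D => S B B0 SB m.
have [N [w [z [wb xE z1]]]] := h m.
pose S' : {linear 'rV[K]_N -> F} := kemb k B^-1 \*: (S \o w).
have S'1 : sup_contraction S'.
  move=> y y1 /=; rewrite rnormZ rnorm_kemb gtr0_norm ?invr_gt0//.
  by rewrite ler_pdivrMl// mulr1 SB// wb.
apply: le_trans (ler_wpM2l (powR_ge0 _ _) (hD N S' S'1 m z z1)).
rewrite mulr_sumr; apply: ler_sum => j _.
rewrite -powRM ?(ltW B0) ?rnorm_ge0//= rnormZ rnorm_kemb gtr0_norm ?invr_gt0//.
by rewrite mulVKf ?gt_eqF// xE.
Qed.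

Lemma Linfty_bounded_walsh_lift : exists2 rho : R, 0 < rho & forall m,
  exists W : {ffun 'I_m -> bool} -> X, (forall e, rnorm (W e) <= rho) /\
  forall j : 'I_m, x j = kemb k (2 ^+ m)^-1 *:
    \sum_(e : {ffun 'I_m -> bool}) ((-1) ^+ (e j) : K) *: W e.
Proof.
have [rho rho0 h] := Linfty_factorization XL wx.
pose c : R := Num.sqrt (2 * expR 1).
have c0 : 0 < c by rewrite sqrtr_gt0 mulr_gt0// expR_gt0.
exists (c * rho); first by rewrite mulr_gt0.
move=> m; have [N [w [z [wb xE z1]]]] := h m.
have [W [Wc zE]] := bounded_walsh_lift z1.
exists (fun e => w (W e)); split=> [e|j].
  have : rnorm (w (kemb k c^-1 *: W e)) <= rho.
    apply: wb => t; rewrite mxE rnormM rnorm_kemb gtr0_norm ?invr_gt0//.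
    by rewrite ler_pdivrMl// mulr1; exact: Wc.
  by rewrite linearZ /= rnormZ rnorm_kemb gtr0_norm ?invr_gt0// ler_pdivrMl.
rewrite xE {1}zE linearZ /= linear_sum; congr (_ *: _).
by apply: eq_bigr => e _; rewrite linearZ.
Qed.

End LinearSummability.

Section MultilinearSummability.
Context {R : realType} {k : scalars} {n : nat}.
Local Notation K := (scalar_field R k).
Context {X : 'I_n -> normedModType K} {F : normedModType K}.
Context (T : prod_topology X -> F) (Tlin : multilinear T).
Context (Tbd : forall rho : R, exists2 B : R, 0 < B &
  forall y : forall s, X s, (forall s, rnorm (y s) <= rho) -> rnorm (T y) <= B).
Context (x : forall s, nat -> X s).
Context (XL : forall s, Linfty_space (X s)) (wx : forall s, weakly_summable 2 (x s)).
Context (q : R) (q2 : 2 <= q) (Fq : has_cotype F q%:E).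

Let q0 : 0 <= q. Proof. by move: q2; lra. Qed.
Let q1 : 1 <= q. Proof. by move: q2; lra. Qed.

(** The variable [s0] is the one that is varied linearly, the variables in [A] have
    been switched to translates of [x s], and the others are frozen. *)
Definition mixed_args (s0 : 'I_n) (A : seq 'I_n) (c : forall s, X s) (j : nat) :
    forall s, X s :=
  fun s => if s == s0 then x s j else if s \in A then c s + x s j else c s.

(** Replacing a frozen variable [c r] by [c r + x r j] adds the term with [x r j]
    in place of [c r]; as [x r j] is the mean of [+- W e] with a bounded [W], it is
    a mean of terms in which the variable is again frozen, and convexity of the
    power [q] finishes the induction. *)
Lemma mixed_args_summing (s0 : 'I_n) (A : seq 'I_n) : forall rho : R, exists D : R,
  forall m (c : forall s, X s), (forall s, rnorm (c s) <= rho) ->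
    \sum_(j < m) rnorm (T (mixed_args s0 A c j)) `^ q <= D.
Proof.
elim: A => [|r A IH] rho.
  have [rho0 rho0_gt0 [D hD]] := Linfty_linear_summing (XL s0) (wx (s := s0)) q2 Fq.
  have [B B0 hB] := Tbd (Num.max rho rho0).
  exists (B `^ q * D) => m c hc.
  have -> : \sum_(j < m) rnorm (T (mixed_args s0 [::] c j)) `^ q =
      \sum_(j < m) rnorm (multilinear_slice Tlin c s0 (x s0 j)) `^ q.
    apply: eq_bigr => j _; congr (rnorm (T _) `^ _).
    apply/functional_extensionality_dep => s; rewrite /mixed_args.
    by have [->|ss] := eqVneq s s0; rewrite ?dfwithin// dfwithout// eq_sym.
  apply: hD => // y yr; apply: hB => s.
  have [<-|ss] := eqVneq s0 s; first by rewrite dfwithin le_max yr orbT.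
  by rewrite dfwithout// le_max hc.
have [rA|rA] := boolP ((r == s0) || (r \in A)).
  have [D hD] := IH rho; exists D => m c hc; apply: le_trans (hD m c hc).
  rewrite le_eqVlt; apply/orP; left; apply/eqP/eq_bigr => j _; congr (rnorm (T _) `^ _).
  apply/functional_extensionality_dep => s; rewrite /mixed_args inE.
  case: (eqVneq s s0) => // ss0; case: (eqVneq s r) => //= sr.
  by move: rA; rewrite -sr (negbTE ss0) /= => ->.
move: rA; rewrite negb_or => /andP[rs0 rA].
have [rhor _ hW] := Linfty_bounded_walsh_lift (XL r) (wx (s := r)).
have [D hD] := IH (Num.max rho rhor).
exists (2 `^ q * (D + D)) => m c hc.
have [W [Wr xW]] := hW m.
have hc' s : rnorm (c s) <= Num.max rho rhor by rewrite le_max hc.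
pose cW e : forall s, X s := dfwith c r (W e).
have hcW e s : rnorm (cW e s) <= Num.max rho rhor.
  rewrite /cW; have [<-|rs] := eqVneq r s; first by rewrite dfwithin le_max Wr orbT.
  by rewrite dfwithout.
pose L j := multilinear_slice Tlin (mixed_args s0 A c j) r.
have mixed_slice (d : X r) j :
    T (mixed_args s0 A (dfwith c r d) j) = L j d.
  congr (T _); apply/functional_extensionality_dep => s; rewrite /mixed_args.
  have [<-|rs] := eqVneq r s; first by rewrite (negbTE rs0) (negbTE rA) !dfwithin.
  by rewrite !dfwithout.
have mixed_cons j : T (mixed_args s0 (r :: A) c j) =
    T (mixed_args s0 A c j) + L j (x r j).
  have -> : T (mixed_args s0 A c j) = L j (c r).
    rewrite -mixed_slice; congr (T (mixed_args _ _ _ _)).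
    apply/functional_extensionality_dep => s.
    by have [<-|rs] := eqVneq r s; rewrite ?dfwithin// dfwithout.
  rewrite -linearD; congr (T _); apply/functional_extensionality_dep => s.
  have [<-|rs] := eqVneq r s.
    by rewrite dfwithin /mixed_args inE eqxx (negbTE rs0).
  by rewrite dfwithout// /mixed_args inE [s == r]eq_sym (negbTE rs).
have walsh (j : 'I_m) : rnorm (L j (x r j)) `^ q <=
    (2 ^+ m)^-1 * \sum_(e : {ffun 'I_m -> bool}) rnorm (T (mixed_args s0 A (cW e) j)) `^ q.
  have cardE : #|{ffun 'I_m -> bool}|%:R^-1 = (2 ^+ m)^-1 :> R by rewrite card_signs natrX.
  rewrite -cardE; apply: le_trans (powR_mean_le q1 (fun e => rnorm_ge0 _)).
  rewrite ge0_ler_powR ?nnegrE ?rnorm_ge0// ?mulr_ge0 ?sumr_ge0//; last first.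
    have -> : L j (x r j) = kemb k (2 ^+ m)^-1 *:
        \sum_(e : {ffun 'I_m -> bool}) ((-1) ^+ (e j) : K) *: L j (W e).
      rewrite {1}xW linearZ linear_sum; congr (_ *: _).
      by apply: eq_bigr => e _; rewrite linearZ.
    rewrite rnormZ rnorm_kemb cardE ger0_norm ?invr_ge0 ?exprn_ge0//.
    rewrite ler_wpM2l ?invr_ge0 ?exprn_ge0//.
    rewrite (le_trans (ler_rnorm_sum _ _))//; apply: ler_sum => e _.
    by rewrite rnormZ rnorm_sign mul1r mixed_slice.
  by move=> e _; exact: rnorm_ge0.
apply: (@le_trans _ _ (\sum_(j < m) 2 `^ q * (rnorm (T (mixed_args s0 A c j)) `^ q +
    (2 ^+ m)^-1 * \sum_(e : {ffun 'I_m -> bool}) rnorm (T (mixed_args s0 A (cW e) j)) `^ q))).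
  apply: ler_sum => j _; rewrite mixed_cons.
  apply: (@le_trans _ _ ((rnorm (T (mixed_args s0 A c j)) + rnorm (L j (x r j))) `^ q)).
    by rewrite ge0_ler_powR ?nnegrE ?addr_ge0 ?rnorm_ge0// ler_rnormD.
  apply: le_trans (powRD_le q0 (rnorm_ge0 _) (rnorm_ge0 _)) _.
  by rewrite ler_wpM2l ?powR_ge0// lerD2l.
rewrite -mulr_sumr ler_wpM2l ?powR_ge0// big_split/= lerD ?hD//.
rewrite -mulr_sumr exchange_big /= ler_pdivrMl ?exprn_gt0//.
apply: (@le_trans _ _ (\sum_(e : {ffun 'I_m -> bool}) D)).
  by apply: ler_sum => e _; apply: hD => s; exact: hcW.
by rewrite sumr_const card_signs -natrX [leRHS]mulr_natl.
Qed.

Lemma multilinear_summing (a : forall s, X s) : exists M : R, forall m,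
  \sum_(j < m) rnorm (T (fun s => a s + x s j) - T a) `^ q <= M.
Proof.
pose rho := \sum_s rnorm (a s).
have arho s : rnorm (a s) <= rho.
  by rewrite /rho (bigD1 s)//= lerDl sumr_ge0// => i _; exact: rnorm_ge0.
pose A (l : 'I_n) := [seq s : 'I_n <- enum 'I_n | (s < l)%N].
have [D hD] := choice (fun l : 'I_n => mixed_args_summing l (A l) rho).
exists (n%:R `^ q * \sum_l D l) => m.
(* The variables are switched from [a s] to [a s + x s j] one after the other. *)
pose Y j (l : nat) : forall s, X s := fun s => if (s < l)%N then a s + x s j else a s.
have tele j : T (fun s => a s + x s j) - T a =
    \sum_(l < n) T (mixed_args l (A l) a j).
  have -> : T (fun s => a s + x s j) = T (Y j n).
    by congr (T _); apply/functional_extensionality_dep => s; rewrite /Y ltn_ord.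
  have -> : T a = T (Y j 0%N) by [].
  rewrite -(telescope_sumr (fun l => T (Y j l)) (leq0n n)) big_mkord.
  apply: eq_bigr => l _.
  have YS : Y j l.+1 = dfwith (Y j l) l (a l + x l j).
    apply/functional_extensionality_dep => s; have [<-|ls] := eqVneq l s.
      by rewrite dfwithin /Y ltnSn.
    by rewrite dfwithout// /Y ltnS leq_eqVlt (inj_eq val_inj) [s == l]eq_sym (negbTE ls).
  have Yl : Y j l = dfwith (Y j l) l (a l).
    apply/functional_extensionality_dep => s; have [<-|ls] := eqVneq l s.
      by rewrite dfwithin /Y ltnn.
    by rewrite dfwithout.
  pose L := multilinear_slice Tlin (Y j l) l.
  have -> : T (Y j l.+1) - T (Y j l) = L (a l + x l j) - L (a l) by rewrite YS {2}Yl.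
  rewrite -linearB addrAC subrr add0r; congr (T _).
  apply/functional_extensionality_dep => s; rewrite /mixed_args.
  have [<-|ls] := eqVneq l s; first by rewrite dfwithin.
  by rewrite dfwithout// /A mem_filter mem_enum andbT.
apply: (@le_trans _ _ (\sum_(j < m) n%:R `^ q *
    \sum_(l < n) rnorm (T (mixed_args l (A l) a j)) `^ q)).
  apply: ler_sum => j _; rewrite tele.
  apply: le_trans (powR_sum_le q1 (fun l => rnorm_ge0 _)).
  by rewrite ge0_ler_powR ?nnegrE ?sumr_ge0 ?rnorm_ge0 ?ler_rnorm_sum// => l _; exact: rnorm_ge0.
rewrite -mulr_sumr ler_wpM2l ?powR_ge0// exchange_big /=.
by apply: ler_sum => l _; exact: hD.
Qed.

End MultilinearSummability.

Theorem theorem10 (R : realType) (k : scalars) (n : nat)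
    (X : 'I_n -> completeNormedModType (scalar_field R k))
    (F : completeNormedModType (scalar_field R k)) (q : \bar R)
    (n_gt0 : (0 < n)%N)
    (X_Linfty : forall j, Linfty_space (X j))
    (cotF : cot F = q) (F_cotype_q : has_cotype F q)
    (T : prod_topology X -> F)
    (T_multilinear : multilinear T) (T_continuous : continuous T)
    (a : forall j, X j) :
  summing_at q (fun=> 2) T a.
Proof.
move=> x wx.
have q_ge2 : (2%:E <= q)%E by rewrite -cotF; apply: le_ereal_inf_tmp => p [].
have Tbd := continuous_multilinear_bounded T_multilinear n_gt0 T_continuous.
case: q cotF F_cotype_q q_ge2 => [q| |] cotF Fq q2 //.
  have [M hM] := multilinear_summing T_multilinear Tbd X_Linfty wx q2 Fq a.
  apply: (@le_lt_trans _ _ M%:E); last exact: ltry.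
  apply: lime_le.
    by apply: is_cvg_nneseries => j _ _; rewrite lee_fin powR_ge0.
  by apply: nearW => m; rewrite sumEFin lee_fin big_mkord.
have [rho hrho] := choice (fun s => Linfty_weakly_summable_bounded (X_Linfty s) (wx s)).
pose r := \sum_s (rnorm (a s) + `|rho s|).
have hr s : rnorm (a s) + `|rho s| <= r.
  by rewrite /r (bigD1 s)//= lerDl sumr_ge0// => i _; rewrite addr_ge0 ?rnorm_ge0.
have [B B0 hB] := Tbd r.
exists (B + B) => j; rewrite (le_trans (ler_rnormD _ _))// rnormN lerD// hB// => s.
  apply: le_trans (hr s); apply: le_trans (ler_rnormD _ _) _.
  by rewrite lerD2l (le_trans (hrho s j))// ler_norm.
by apply: le_trans (hr s); rewrite lerDl.
Qed.
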